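(* Let $X_1$ and $X_2$ be Hilbert spaces and $Y$ a Banach space, let $A_1:\mathcal{D}(A_1)\subset X_1\to X_1$ and $A_2:\mathcal{D}(A_2)\subset X_2\to X_2$ generate strongly continuous semigroups $T_1(t)$ and $T_2(t)$, respectively, and let $B\in\mathcal{L}(Y,X_1)$ and $C\in\mathcal{L}(X_2,Y)$. Let $T(t)$ be the semigroup generated on $X=X_1\times X_2$ by $$A=\begin{pmatrix}A_1&BC\\0&A_2\end{pmatrix},\qquad \mathcal{D}(A)=\mathcal{D}(A_1)\times\mathcal{D}(A_2).$$ (1) If $T_1(t)$ is exponentially stable and $T_2(t)$ is polynomially stable with $\alpha_2>0$, then $T(t)$ is polynomially stable with $\alpha=\alpha_2$. (2) If $T_2(t)$ is exponentially stable and $T_1(t)$ is polynomially stable with $\alpha_1>0$, then $T(t)$ is polynomially stable with $\alpha=\alpha_1$.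
   Context: $\mathcal{D}(\cdot)$ denotes the domain, $\rho(\cdot)$ the resolvent set, and $\mathcal{L}(X,Y)$ the bounded linear operators from $X$ to $Y$. A strongly continuous semigroup $T(t)$ with generator $A$ is polynomially stable with $\alpha>0$ if $T(t)$ is uniformly bounded ($\sup_{t\ge0}\|T(t)\|<\infty$), $i\mathbb{R}\subset\rho(A)$, and there exists $M\geq1$ such that $\|T(t)A^{-1}\|\leq M t^{-1/\alpha}$ for all $t>0$. It is exponentially stable if there exist $M\geq 1$, $\omega>0$ with $\|T(t)\|\leq Me^{-\omega t}$ for all $t\geq0$. *)

(* Defs.v *)
From Stdlib Require Import Reals.
From Coquelicot Require Import Coquelicot.

Set Implicit Arguments.
Unset Strict Implicit.

Open Scope R_scope.

#[local] Obligation Tactic := idtac.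

Notation C_NormedSpace := (NormedModule C_AbsRing).
Notation C_BanachSpace := (CompleteNormedModule C_AbsRing).

(* A complex Banach space whose norm comes from an inner product; the inner
   product is linear in its first argument.  Positive definiteness follows
   from [inner_norm]. *)
Record HilbertSpace : Type := MkHilbertSpace {
  hilbert_banach :> C_BanachSpace;
  inner : hilbert_banach -> hilbert_banach -> C;
  inner_plus_l : forall x y z,
    inner (plus x y) z = (inner x z + inner y z)%C;
  inner_scal_l : forall (k : C) x y, inner (scal k x) y = (k * inner x y)%C;
  inner_conj : forall x y, inner y x = Cconj (inner x y);
  inner_norm : forall x, inner x x = RtoC (norm x ^ 2)
}.

(* The operator norm, [p_infty] for an unbounded map. *)
Definition op_norm (U V : C_NormedSpace) (f : U -> V) : Rbar :=
  Lub_Rbar (fun r : R => exists x : U, norm x <= 1 /\ r = norm (f x)).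

(* A linear operator D(A) c X -> X.  [op] is a total function, but its values
   outside [dom] are arbitrary and never used. *)
Record LinOp (X : C_NormedSpace) : Type := MkLinOp {
  dom : X -> Prop;
  op :> X -> X;
  dom_zero : dom zero;
  dom_plus : forall x y, dom x -> dom y -> dom (plus x y);
  dom_scal : forall (k : C) x, dom x -> dom (scal k x);
  op_plus : forall x y, dom x -> dom y -> op (plus x y) = plus (op x) (op y);
  op_scal : forall (k : C) x, dom x -> op (scal k x) = scal k (op x)
}.

Lemma plus_plus_swap (G : AbelianGroup) (a b c d : G) :
  plus (plus a b) (plus c d) = plus (plus a c) (plus b d).
Proof.
now rewrite <- !plus_assoc, (plus_assoc b c), (plus_comm b c), !plus_assoc.
Qed.

Lemma minus_plus_plus (G : AbelianGroup) (u v a b : G) :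
  minus (plus u v) (plus a b) = plus (minus u a) (minus v b).
Proof. unfold minus; rewrite opp_plus; apply plus_plus_swap. Qed.

Lemma minus_scal_scal (V : ModuleSpace C_Ring) (l k : C) (x a : V) :
  minus (scal l (scal k x)) (scal k a) = scal k (minus (scal l x) a).
Proof.
rewrite scal_minus_distr_l, !scal_assoc; do 2 f_equal; apply Cmult_comm.
Qed.

(* The operator lambda - A, with domain D(A). *)
Program Definition shift (X : C_NormedSpace) (lambda : C) (A : LinOp X)
    : LinOp X :=
  {| dom := dom A; op := fun x => minus (scal lambda x) (A x) |}.
Next Obligation. intros; apply dom_zero. Qed.
Next Obligation. intros; now apply dom_plus. Qed.
Next Obligation. intros; now apply dom_scal. Qed.
Next Obligation.
intros X lambda A x y Hx Hy; cbn beta; rewrite (op_plus Hx Hy).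
rewrite (scal_distr_l (V := X) lambda x y : scal lambda (plus x y) = _).
exact (minus_plus_plus (G := X) _ _ (A x) (A y)).
Qed.
Next Obligation.
intros X lambda A k x Hx; cbn beta; rewrite (op_scal k Hx).
exact (minus_scal_scal (V := X) lambda k x (A x)).
Qed.

(* [S] is the inverse of [A : D(A) -> X] and lies in L(X); note that Coquelicot's
   [is_linear] means linear and bounded. *)
Definition bounded_inverse (X : C_NormedSpace) (A : LinOp X) (S : X -> X)
    : Prop :=
  is_linear S /\
  (forall x, dom A (S x) /\ A (S x) = x) /\
  (forall x, dom A x -> S (A x) = x).

Definition resolvent_set (X : C_NormedSpace) (A : LinOp X) (lambda : C)
    : Prop :=
  exists S : X -> X, bounded_inverse (shift lambda A) S.

(* Only the values of [T] at t >= 0 matter. *)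
Definition C0_semigroup (X : C_NormedSpace) (T : R -> X -> X) : Prop :=
  (forall t, 0 <= t -> is_linear (T t)) /\
  (forall x, T 0 x = x) /\
  (forall s t x, 0 <= s -> 0 <= t -> T (s + t) x = T s (T t x)) /\
  (forall x, filterlim (fun t => T t x) (at_right 0) (locally x)).

(* The last clause says both that D(A) is the set of x at which the difference
   quotient converges and that A x is the limit. *)
Definition generates (X : C_NormedSpace) (A : LinOp X) (T : R -> X -> X)
    : Prop :=
  C0_semigroup T /\
  (forall x y, (dom A x /\ A x = y) <->
     filterlim (fun h => scal (RtoC (/ h)) (minus (T h x) x))
       (at_right 0) (locally y)).

Definition exponentially_stable (X : C_NormedSpace) (T : R -> X -> X) : Prop :=
  exists M omega : R, 1 <= M /\ 0 < omega /\
    forall t, 0 <= t -> Rbar_le (op_norm (T t)) (M * exp (- omega * t)).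

(* For a semigroup [T] with generator [A]. *)
Definition polynomially_stable (X : C_NormedSpace) (alpha : R) (A : LinOp X)
    (T : R -> X -> X) : Prop :=
  (exists K : R, forall t, 0 <= t -> Rbar_le (op_norm (T t)) K) /\
  (forall omega : R, resolvent_set A (0, omega)) /\
  (exists Ainv : X -> X, bounded_inverse A Ainv /\
     exists M : R, 1 <= M /\
       forall t, 0 < t ->
         Rbar_le (op_norm (fun x => T t (Ainv x)))
           (M * Rpower t (- 1 / alpha))).

(* The operator ((A1, BC), (0, A2)) with domain D(A1) x D(A2).  The norm of
   [prod_NormedModule] is sqrt (|x1|^2 + |x2|^2), that is, the norm of the
   Hilbert space X1 x X2. *)
Program Definition block_op (X1 X2 Y : C_NormedSpace) (A1 : LinOp X1)
    (A2 : LinOp X2) (B : Y -> X1) (C : X2 -> Y)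
    (hB : is_linear B) (hC : is_linear C)
    : LinOp (prod_NormedModule C_AbsRing X1 X2) :=
  {| dom := fun x => dom A1 (fst x) /\ dom A2 (snd x);
     op := fun x => (plus (A1 (fst x)) (B (C (snd x))), A2 (snd x)) |}.
Next Obligation. intros; split; apply dom_zero. Qed.
Next Obligation.
intros X1 X2 Y A1 A2 B C hB hC x y [] []; split; now apply dom_plus.
Qed.
Next Obligation.
intros X1 X2 Y A1 A2 B C hB hC k x []; split; now apply dom_scal.
Qed.
Next Obligation.
intros X1 X2 Y A1 A2 B C hB hC [x1 x2] [y1 y2] [Hx1 Hx2] [Hy1 Hy2].
refine (f_equal2 pair _ (op_plus Hx2 Hy2)).
refine (eq_trans (f_equal2 plus (op_plus Hx1 Hy1) _)
  (plus_plus_swap (G := X1) _ _ _ _)).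
exact (eq_trans (f_equal B (linear_plus C hC x2 y2)) (linear_plus B hB _ _)).
Qed.
Next Obligation.
intros X1 X2 Y A1 A2 B C hB hC k [x1 x2] [Hx1 Hx2].
refine (f_equal2 pair _ (op_scal k Hx2)).
refine (eq_trans (f_equal2 plus (op_scal k Hx1) _)
  (eq_sym (scal_distr_l (V := X1) _ _ _))).
exact (eq_trans (f_equal B (linear_scal C hC k x2)) (linear_scal B hB _ _)).
Qed.

(* Main.v *)
Require Import Defs.
From Stdlib Require Import Reals Lra Lia List Classical IndefiniteDescription.
From Coquelicot Require Import Coquelicot.
Open Scope R_scope.

(* By variation of constants, [T t (x1, x2) = (T1 t x1 + S t x2, T2 t x2)] with
   [S t = int_0^t T1 (t - s) B C T2 s ds], so [T] is bounded as soon as one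
   diagonal semigroup is bounded and the other decays exponentially; the
   resolvent of [A] is triangular.  For the decay, put [tau = t / 2].
   If [T1] decays exponentially, [T t = T tau T tau] is used on [A^-1 x]: on
   [[tau, t]] the second component is of size [tau^(-1/alpha)], and what the
   first component carries from time [tau] is damped by [T1 tau].
   If [T2] decays exponentially, [A^-1] is moved to the left,
   [T t A^-1 = A^-1 T t], because the input [B C x2] of the first equation need
   not lie in [D(A1)]; at time [tau] the second component is exponentially
   small and [T1 tau A1^-1] decays.
   The convolution is never formed: it is only estimated, by a mean value
   inequality applied to [s |-> T1 (t - s) (fst (T s x))] for [x] in [D(A)], and
   the bounds extend by density.  Local boundedness of [T], which gives the left
   continuity needed there, is the uniform boundedness principle. *)

(** * Linear identities in modules *)

(** The rate must come out as [t^(-1/alpha)] without loss, although this power need be integrable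
    neither at 0 nor at infinity. It is therefore never integrated: where it enters the convolution,
    it is replaced on the second half of [[0, t]] by its value at [tau], and only the exponential
    factor is integrated, at the cost of [1 / omega]. Halving the time costs the constant
    [2^(1/alpha)]. Exponentials are at most a constant times [t^(-1/alpha)] for all [t > 0], so
    small times need no separate treatment. The generator is a one-sided limit, so the calculus is
    done with right derivatives. A bound on a right derivative says nothing about a jump from the
    left, which is why continuity from the left has to be supplied separately at each use. *)

Inductive vexpr : Type :=
| VVar (n : nat) | VZero | VPlus (a b : vexpr) | VOpp (a : vexpr)
| VMinus (a b : vexpr) | VScal (k : C) (a : vexpr).

Fixpoint vden (V : C_NormedSpace) (env : list V) (e : vexpr) : V :=
  match e with
  | VVar n => nth n env zero
  | VZero => zero
  | VPlus a b => plus (vden V env a) (vden V env b)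
  | VOpp a => opp (vden V env a)
  | VMinus a b => minus (vden V env a) (vden V env b)
  | VScal k a => scal k (vden V env a)
  end.

Fixpoint vcoef (e : vexpr) (i : nat) : C :=
  match e with
  | VVar n => if Nat.eqb n i then RtoC 1 else RtoC 0
  | VZero => RtoC 0
  | VPlus a b => (vcoef a i + vcoef b i)%C
  | VOpp a => (- vcoef a i)%C
  | VMinus a b => (vcoef a i - vcoef b i)%C
  | VScal k a => (k * vcoef a i)%C
  end.

Fixpoint lincomb (V : C_NormedSpace) (c : nat -> C) (env : list V) : V :=
  match env with
  | nil => zero
  | v :: l => plus (scal (c O) v) (lincomb V (fun i => c (S i)) l)
  end.

Lemma lincomb_ext (V : C_NormedSpace) (env : list V) (c d : nat -> C) :
  (forall i, (i < length env)%nat -> c i = d i) ->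
  lincomb V c env = lincomb V d env.
Proof.
revert c d; induction env as [|v l IH]; intros c d H; [reflexivity|]; simpl.
rewrite (H O) by (simpl; lia); f_equal.
apply IH; intros i Hi; apply H; simpl; lia.
Qed.

Lemma lincomb_zero (V : C_NormedSpace) (env : list V) :
  lincomb V (fun _ => RtoC 0) env = zero.
Proof.
induction env as [|v l IH]; [reflexivity|]; simpl; rewrite IH, plus_zero_r.
exact (scal_zero_l v).
Qed.

Lemma lincomb_plus (V : C_NormedSpace) (env : list V) (c d : nat -> C) :
  lincomb V (fun i => (c i + d i)%C) env
  = plus (lincomb V c env) (lincomb V d env).
Proof.
revert c d; induction env as [|v l IH]; intros c d; simpl.
- now rewrite plus_zero_l.
- rewrite IH, <- (plus_plus_swap (G := V)); f_equal.
  exact (scal_distr_r (c O) (d O) v).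
Qed.

Lemma lincomb_scal (V : C_NormedSpace) (env : list V) (k : C) (c : nat -> C) :
  lincomb V (fun i => (k * c i)%C) env = scal k (lincomb V c env).
Proof.
revert c; induction env as [|v l IH]; intros c; simpl.
- symmetry; exact (scal_zero_r k).
- rewrite IH; symmetry.
  refine (eq_trans (scal_distr_l k _ _) _); f_equal.
  exact (scal_assoc k (c O) v).
Qed.

Lemma scal_opp_one_C (V : C_NormedSpace) (x : V) :
  scal (RtoC (-1)) x = opp x.
Proof.
refine (eq_trans _ (scal_opp_one x)); apply (f_equal (fun k => scal k x)).
apply injective_projections; simpl; ring.
Qed.

Lemma lincomb_opp (V : C_NormedSpace) (env : list V) (c : nat -> C) :
  lincomb V (fun i => (- c i)%C) env = opp (lincomb V c env).
Proof.
rewrite <- scal_opp_one_C, <- lincomb_scal; apply lincomb_ext.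
intros; ring.
Qed.

Lemma vden_lincomb (V : C_NormedSpace) (env : list V) (e : vexpr) :
  vden V env e = lincomb V (vcoef e) env.
Proof.
induction e as [n| |a IHa b IHb|a IHa|a IHa b IHb|k a IHa]; simpl.
- revert n; induction env as [|v l IH]; intros n; [now destruct n|].
  destruct n as [|n]; simpl.
  + rewrite lincomb_zero, plus_zero_r.
    symmetry; exact (scal_one v).
  + rewrite IH.
    transitivity (plus zero (lincomb V
      (fun i => if Nat.eqb n i then RtoC 1 else RtoC 0) l));
      [now rewrite plus_zero_l|].
    f_equal; symmetry; exact (scal_zero_l v).
- now rewrite lincomb_zero.
- now rewrite IHa, IHb, lincomb_plus.
- now rewrite IHa, lincomb_opp.
- rewrite IHa, IHb; unfold minus; rewrite <- lincomb_opp.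
  symmetry; exact (lincomb_plus V env (vcoef a) (fun i => (- vcoef b i)%C)).
- now rewrite IHa, lincomb_scal.
Qed.

(* Soundness of the reflective tactic [module]. *)
Lemma vden_eq (V : C_NormedSpace) (env : list V) (e1 e2 : vexpr) :
  (forall i, (i < length env)%nat -> vcoef e1 i = vcoef e2 i) ->
  vden V env e1 = vden V env e2.
Proof. rewrite !vden_lincomb; apply lincomb_ext. Qed.

Ltac v_mem x l :=
  match l with
  | nil => constr:(false)
  | x :: _ => constr:(true)
  | _ :: ?l' => v_mem x l'
  end.

Ltac v_atoms env t :=
  lazymatch t with
  | zero => env
  | plus ?a ?b => let env := v_atoms env a in v_atoms env b
  | minus ?a ?b => let env := v_atoms env a in v_atoms env b
  | opp ?a => v_atoms env a
  | scal _ ?a => v_atoms env a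
  | _ => match v_mem t env with
         | true => env
         | false => constr:(t :: env)
         end
  end.

Ltac v_index x l :=
  match l with
  | x :: _ => constr:(O)
  | _ :: ?l' => let n := v_index x l' in constr:(S n)
  end.

Ltac v_reify env t :=
  lazymatch t with
  | zero => constr:(VZero)
  | plus ?a ?b =>
    let a := v_reify env a in let b := v_reify env b in constr:(VPlus a b)
  | minus ?a ?b =>
    let a := v_reify env a in let b := v_reify env b in constr:(VMinus a b)
  | opp ?a => let a := v_reify env a in constr:(VOpp a)
  | scal ?k ?a => let a := v_reify env a in constr:(VScal k a)
  | _ => let n := v_index t env in constr:(VVar n)
  end.

(** One scalar equation per atom. If [ring] does not settle it in the complex numbers, it is split
    into real and imaginary parts; what then remains, typically an identity with inverses, is left
    to the caller. *)
Ltac v_coefs env i Hi :=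
  lazymatch env with
  | nil => exfalso; cbn in Hi; lia
  | _ :: ?env' =>
    destruct i as [|i];
    [clear Hi; cbv [vcoef Nat.eqb];
     first [ring | apply injective_projections; simpl; try ring]
    | v_coefs env' i Hi]
  end.

Ltac module V :=
  lazymatch goal with
  | |- ?l = ?r =>
    let env := v_atoms (@nil V) l in
    let env := v_atoms env r in
    let el := v_reify env l in
    let er := v_reify env r in
    change (vden V env el = vden V env er);
    apply vden_eq;
    let i := fresh "i" in let Hi := fresh "Hi" in
    intros i Hi;
    v_coefs env i Hi
  end.

(** * Norms, one-sided derivatives and the mean value inequality *)

Lemma norm_scal_le (V : C_NormedSpace) (h : R) (x : V) :
  norm (scal (RtoC h) x) <= Rabs h * norm x.
Proof. rewrite <- Cmod_R; exact (norm_scal (RtoC h) x). Qed.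

(** The norm axiom is only an inequality; the converse comes from applying it to the scalar [/ h]
    and the vector [scal h x]. *)
Lemma norm_scal_eq (V : C_NormedSpace) (h : R) (x : V) :
  0 <= h -> norm (scal (RtoC h) x) = h * norm x.
Proof.
intros [Hh| <-].
- apply Rle_antisym.
  + rewrite <- (Rabs_pos_eq h) at 2 by lra; apply norm_scal_le.
  + assert (Hx : x = scal (RtoC (/ h)) (scal (RtoC h) x))
      by (module V; field; lra).
    apply Rmult_le_reg_l with (/ h); [now apply Rinv_0_lt_compat|].
    rewrite <- Rmult_assoc, Rinv_l, Rmult_1_l by lra.
    rewrite Hx at 1.
    rewrite <- (Rabs_pos_eq (/ h)) at 2
      by (apply Rlt_le, Rinv_0_lt_compat; lra).
    apply norm_scal_le.
- replace (scal (RtoC 0) x) with (zero : V) by (module V).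
  rewrite norm_zero; ring.
Qed.

Lemma norm_sub_sym (V : C_NormedSpace) (x y : V) :
  norm (minus x y) = norm (minus y x).
Proof.
rewrite <- norm_opp; apply (f_equal norm); module V.
Qed.

Lemma norm_plus_le (V : C_NormedSpace) (a b c : V) :
  a = plus b c -> norm a <= norm b + norm c.
Proof. intros ->; apply norm_triangle. Qed.

Lemma norm_plus3_le (V : C_NormedSpace) (a b c d : V) :
  a = plus b (plus c d) -> norm a <= norm b + norm c + norm d.
Proof.
intros H; apply norm_plus_le in H.
assert (H' := norm_plus_le V _ c d eq_refl); lra.
Qed.

Lemma norm_minus_le (V : C_NormedSpace) (a b c : V) :
  a = minus b c -> norm a <= norm b + norm c.
Proof.
intros ->; rewrite <- (norm_opp c); apply norm_plus_le; module V.
Qed.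

Lemma norm_dist_le (V : C_NormedSpace) (x y z : V) :
  norm (minus x z) <= norm (minus x y) + norm (minus y z).
Proof. apply norm_plus_le; module V. Qed.

Lemma small_norm_zero (V : C_NormedSpace) (x : V) :
  (forall eps, 0 < eps -> norm x <= eps) -> x = zero.
Proof.
intros H; apply norm_eq_zero; apply Rle_antisym; [|apply norm_ge_0].
apply le_epsilon; intros eps He; rewrite Rplus_0_l; now apply H.
Qed.

Lemma minus_zero_eq (V : C_NormedSpace) (x y : V) : minus x y = zero -> x = y.
Proof.
intros H; transitivity (plus y (minus x y)); [module V|].
rewrite H; module V.
Qed.

Lemma Rinv_mult_cancel (h a b : R) : 0 < h -> a <= b * h -> / h * a <= b.
Proof.
intros Hh H; apply Rmult_le_reg_l with h; [easy|].
rewrite <- Rmult_assoc, Rinv_r, Rmult_1_l by lra; lra.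
Qed.

Lemma filterlim_right_iff (V : C_NormedSpace) (f : R -> V) (y : V) :
  filterlim f (at_right 0) (locally y) <->
  (forall eps, 0 < eps -> exists delta, 0 < delta /\
     forall h, 0 < h < delta -> norm (minus (f h) y) <= eps).
Proof.
rewrite (@filterlim_locally_ball_norm C_AbsRing R V (at_right 0) _ f y).
split.
- intros H eps He; destruct (H (mkposreal eps He)) as [d Hd].
  exists d; split; [apply cond_pos|]; intros h Hh.
  apply Rlt_le; apply Hd; [|lra].
  change (Rabs (h - 0) < d); rewrite Rminus_0_r, Rabs_pos_eq; lra.
- intros H [eps He]; destruct (H (eps / 2)) as [d [Hd1 Hd2]]; [lra|].
  exists (mkposreal d Hd1); intros h Hh Hp.
  change (Rabs (h - 0) < d) in Hh; rewrite Rminus_0_r, Rabs_pos_eq in Hh by lra.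
  apply Rle_lt_trans with (eps / 2); [apply Hd2; lra| simpl; lra].
Qed.

(** Right derivative, with the difference quotient cleared of its denominator so that remainders can
    be added and mapped by bounded operators without division. *)
Definition rderiv (V : C_NormedSpace) (u : R -> V) (s : R) (y : V) : Prop :=
  forall eps, 0 < eps -> exists delta, 0 < delta /\
    forall h, 0 < h < delta ->
      norm (minus (minus (u (s + h)) (u s)) (scal (RtoC h) y)) <= eps * h.

Lemma rderiv_iff_filterlim (V : C_NormedSpace) (u : R -> V) (y : V) :
  filterlim (fun h => scal (RtoC (/ h)) (minus (u h) (u 0))) (at_right 0)
    (locally y) <-> rderiv V u 0 y.
Proof.
refine (iff_trans (filterlim_right_iff V _ y) _); unfold rderiv.
split; intros H eps He; destruct (H eps He) as [d [Hd1 Hd2]];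
  exists d; (split; [easy|]); intros h Hh; specialize (Hd2 h Hh);
  cbv beta in Hd2 |- *.
- rewrite Rplus_0_l.
  replace (minus (minus (u h) (u 0)) (scal (RtoC h) y)) with
    (scal (RtoC h) (minus (scal (RtoC (/ h)) (minus (u h) (u 0))) y))
    by (module V; field; lra).
  rewrite norm_scal_eq by lra; rewrite (Rmult_comm eps).
  apply Rmult_le_compat_l; [lra|exact Hd2].
- rewrite Rplus_0_l in Hd2; cbv beta.
  assert (E : minus (scal (RtoC (/ h)) (minus (u h) (u 0))) y =
    scal (RtoC (/ h)) (minus (minus (u h) (u 0)) (scal (RtoC h) y)))
    by (module V; field; lra).
  assert (0 < / h) by (apply Rinv_0_lt_compat; lra).
  refine (Rle_trans _ _ _ (Req_le _ _ (f_equal norm E)) _).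
  rewrite norm_scal_eq by lra.
  apply Rinv_mult_cancel; [lra|exact Hd2].
Qed.

Lemma generates_iff (X : C_NormedSpace) (A : LinOp X) (T : R -> X -> X) :
  generates A T ->
  forall x y, (dom A x /\ A x = y) <-> rderiv X (fun t => T t x) 0 y.
Proof.
intros [HT HA] x y; rewrite HA, <- rderiv_iff_filterlim.
destruct HT as (_ & H0 & _); now rewrite H0.
Qed.

Lemma linear_map_minus (U V : C_NormedSpace) (f : U -> V) :
  is_linear f -> forall x y, f (minus x y) = minus (f x) (f y).
Proof.
intros Hf x y; replace (minus x y) with (plus x (scal (RtoC (-1)) y))
  by (module U).
rewrite (linear_plus f Hf).
refine (eq_trans (f_equal (plus (f x)) (linear_scal f Hf _ _)) _).
module V.
Qed.

Lemma linear_map_zero (U V : C_NormedSpace) (f : U -> V) :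
  is_linear f -> f zero = zero.
Proof.
intros Hf; transitivity (f (minus zero zero)).
- apply f_equal; module U.
- rewrite (linear_map_minus U V f Hf); module V.
Qed.

Lemma linear_map_scal (U V : C_NormedSpace) (f : U -> V) :
  is_linear f -> forall (k : C) (x : U), f (scal k x) = scal k (f x).
Proof. intros Hf k x; exact (linear_scal f Hf k x). Qed.

Lemma op_norm_le_bound (U V : C_NormedSpace) (f : U -> V) (K : R) :
  is_linear f -> Rbar_le (op_norm f) K -> forall x, norm (f x) <= K * norm x.
Proof.
intros Hf HK x.
assert (H1 : forall u : U, norm u <= 1 -> norm (f u) <= K).
{ intros u Hu.
  assert (H : Rbar_le (norm (f u)) (op_norm f)).
  { apply (proj1 (Lub_Rbar_correct _)); now exists u. }
  exact (Rbar_le_trans _ _ _ H HK). }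
destruct (norm_ge_0 x) as [Hx|Hx].
- assert (Hi : 0 < / norm x) by now apply Rinv_0_lt_compat.
  assert (E : norm (f x) = norm x * norm (f (scal (RtoC (/ norm x)) x))).
  { refine (eq_trans _ (eq_sym (f_equal (fun v => norm x * norm v)
      (linear_scal f Hf _ _)))).
    refine (eq_trans _ (eq_sym (f_equal (Rmult (norm x))
      (norm_scal_eq V _ _ _)))); [|lra].
    field; lra. }
  rewrite E, Rmult_comm; apply Rmult_le_compat_r; [lra|].
  apply H1; rewrite norm_scal_eq by lra; rewrite Rinv_l; lra.
- replace x with (zero : U) by (symmetry; apply norm_eq_zero; easy).
  rewrite (linear_map_zero U V f Hf), !norm_zero; lra.
Qed.

Lemma op_norm_le_intro (U V : C_NormedSpace) (f : U -> V) (K : R) :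
  0 <= K -> (forall x, norm (f x) <= K * norm x) -> Rbar_le (op_norm f) K.
Proof.
intros HK H; apply (proj2 (Lub_Rbar_correct _)); intros r [x [Hx ->]]; simpl.
apply Rle_trans with (1 := H x); rewrite <- (Rmult_1_r K) at 2.
apply Rmult_le_compat_l; lra.
Qed.

Lemma linear_map_bound (U V : C_NormedSpace) (f : U -> V) :
  is_linear f -> exists M, 0 < M /\ forall x, norm (f x) <= M * norm x.
Proof. intros Hf; exact (linear_norm f Hf). Qed.

(** Let [c] be the supremum of the [s] such that [P] holds on [[a, s]]. The closure hypothesis gives
    [P c], and the opening hypothesis excludes [c < b]. *)
Lemma real_induction (P : R -> Prop) (a b : R) :
  a <= b -> P a ->
  (forall s, a <= s < b -> P s -> exists delta, 0 < delta /\
     forall h, 0 < h < delta -> s + h <= b -> P (s + h)) ->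
  (forall s, a < s <= b -> (forall r, a <= r < s -> P r) -> P s) ->
  P b.
Proof.
intros Hab Ha Hopen Hcl.
set (E := fun s => a <= s <= b /\ forall r, a <= r <= s -> P r).
assert (Ea : E a).
{ split; [lra|]; intros r Hr; now replace r with a by lra. }
destruct (completeness E) as [c [Hc1 Hc2]].
- exists b; intros s [Hs _]; lra.
- now exists a.
- assert (Hac : a <= c) by now apply Hc1.
  assert (Hcb : c <= b) by (apply Hc2; intros s [Hs _]; lra).
  assert (Hlt : forall r, a <= r < c -> P r).
  { intros r Hr; apply NNPP; intros Hn.
    assert (c <= r); [|lra].
    apply Hc2; intros s [Hs1 Hs2]; apply Rnot_lt_le; intros Hrs.
    apply Hn, Hs2; lra. }
  assert (Pc : P c).
  { destruct Hac as [Hac|Hac]; [apply Hcl; [lra|easy]|now rewrite <- Hac]. }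
  destruct Hcb as [Hcb|Hcb]; [|now rewrite <- Hcb].
  exfalso; destruct (Hopen c) as [d [Hd1 Hd2]]; [lra|easy|].
  set (h := Rmin (d / 2) (b - c)).
  assert (Hh : 0 < h) by (apply Rmin_glb_lt; lra).
  assert (Hh1 : h <= d / 2) by apply Rmin_l.
  assert (Hh2 : h <= b - c) by apply Rmin_r.
  assert (c + h <= c); [|lra].
  apply Hc1; split; [lra|]; intros r Hr.
  destruct (Rlt_le_dec r c) as [H1|[H1|H1]]; [apply Hlt; lra| |now rewrite <- H1].
  replace r with (c + (r - c)) by ring; apply Hd2; lra.
Qed.

(** The restriction [a <= r] keeps to times at which [f] is meaningful: a semigroup is arbitrary at
    negative times. *)
Definition left_cont (V : C_NormedSpace) (f : R -> V) (a s : R) : Prop :=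
  forall eps, 0 < eps -> exists delta, 0 < delta /\
    forall r, a <= r <= s -> s - delta < r -> norm (minus (f r) (f s)) <= eps.

(** Real induction on the inequality with the slack [e * (s - a)], which absorbs the local errors
    [e * h] as they add up. At a limit point, left continuity of [f] and monotonicity of [G]
    suffice. *)
Lemma growth_bound (V : C_NormedSpace) (f : R -> V) (G : R -> R) (a b : R) :
  a <= b ->
  (forall s, a < s <= b -> left_cont V f a s) ->
  (forall r s, r <= s -> G r <= G s) ->
  (forall s eps, a <= s < b -> 0 < eps -> exists delta, 0 < delta /\
     forall h, 0 < h < delta -> s + h <= b ->
       norm (minus (f (s + h)) (f s)) <= G (s + h) - G s + eps * h) ->
  norm (minus (f b) (f a)) <= G b - G a.
Proof.
intros Hab Hcont HG Hgr; apply le_epsilon; intros eps He.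
(* The total slack [e * (b - a)] stays below [eps]; the added 1 covers [a = b]. *)
set (e := eps / (b - a + 1)).
assert (He' : 0 < e) by (apply Rdiv_lt_0_compat; lra).
apply Rle_trans with (G b - G a + e * (b - a)).
- apply (real_induction
    (fun s => norm (minus (f s) (f a)) <= G s - G a + e * (s - a)) a b Hab).
  + replace (minus (f a) (f a)) with (zero : V) by (module V).
    rewrite norm_zero; lra.
  + intros s Hs IH; destruct (Hgr s e Hs He') as [d [Hd1 Hd2]].
    exists d; split; [easy|]; intros h Hh Hsh; specialize (Hd2 h Hh Hsh).
    assert (H := norm_dist_le V (f (s + h)) (f s) (f a)).
    lra.
  + intros s Hs IH; apply le_epsilon; intros eta Heta.
    destruct (Hcont s Hs eta Heta) as [d [Hd1 Hd2]].
    set (r := Rmax a (s - d / 2)).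
    assert (Hr : a <= r < s)
      by (split; [apply Rmax_l | apply Rmax_lub_lt; lra]).
    assert (Hr2 : s - d / 2 <= r) by apply Rmax_r.
    assert (H1 := IH r Hr); specialize (Hd2 r ltac:(lra) ltac:(lra)).
    rewrite norm_sub_sym in Hd2.
    assert (H := norm_dist_le V (f s) (f r) (f a)).
    assert (HGr := HG r s ltac:(lra)).
    assert (e * (r - a) <= e * (s - a)) by (apply Rmult_le_compat_l; lra).
    lra.
- apply Rplus_le_compat_l; unfold e; apply Rmult_le_reg_r with (b - a + 1); [lra|].
  replace (eps / (b - a + 1) * (b - a) * (b - a + 1)) with (eps * (b - a))
    by (field; lra).
  apply Rmult_le_compat_l; lra.
Qed.

(** * Uniform boundedness and continuity of orbits *)

(** Completeness with explicit radii: the limit inherits the bounds [r k]. This serves both the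
    nested balls of the uniform boundedness principle and the tails of an improper integral. *)
Definition seq_complete (V : C_NormedSpace) : Prop :=
  forall (x : nat -> V) (r : nat -> R),
  (forall k m, (k <= m)%nat -> norm (minus (x m) (x k)) <= r k) ->
  (forall eps, 0 < eps -> exists N, r N <= eps) ->
  exists z, forall k, norm (minus z (x k)) <= r k.

Lemma seq_complete_banach (V : C_BanachSpace) : seq_complete V.
Proof.
intros x r Hx Hr.
destruct (proj1 (filterlim_locally_cauchy (F := eventually) x)) as [z Hz].
- intros eps; destruct (Hr (eps / 3)) as [N HN];
    [assert (H := cond_pos eps); lra|].
  exists (fun n => (N <= n)%nat); split; [now exists N|].
  intros u v Hu Hv; apply (norm_compat1 (K := C_AbsRing) (V := V)).
  assert (H1 := Hx N u Hu); assert (H2 := Hx N v Hv).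
  rewrite norm_sub_sym in H1.
  assert (H := norm_dist_le V (x v) (x N) (x u)).
  refine (Rle_lt_trans _ _ _ H _); assert (He := cond_pos eps); lra.
- exists z; intros k; apply le_epsilon; intros eps He.
  destruct (proj1 (filterlim_locally_ball_norm (K := C_AbsRing) (U := V) x z)
    Hz (mkposreal eps He)) as [N HN].
  assert (H1 : norm (minus (x (max N k)) z) < eps) by (apply HN; lia).
  assert (H2 := Hx k (max N k) ltac:(lia)).
  rewrite norm_sub_sym in H1.
  assert (H := norm_dist_le V z (x (max N k)) (x k)).
  lra.
Qed.

(* The one step of the gliding hump: one of [x + v], [x - v] is mapped to a
   vector at least as large as the image of [v]. *)
Lemma hump_step (V W : C_NormedSpace) (f : V -> W) (k r : R) (x u : V) :
  is_linear f -> 0 < r -> 0 <= k ->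
  4 * (k + 1) / r * norm u < norm (f u) ->
  forall e, 0 < e ->
  exists x' r', 0 < r' <= e /\ norm (minus x' x) + r' <= r /\
    forall y, norm (minus y x') <= r' -> k < norm (f y).
Proof.
intros Hf Hr Hk Hu e He.
assert (Hu0 : 0 < norm u).
{ destruct (norm_ge_0 u) as [H|H]; [easy|exfalso].
  replace u with (zero : V) in Hu by (symmetry; now apply norm_eq_zero).
  rewrite (linear_map_zero V W f Hf), !norm_zero in Hu; lra. }
assert (Hc : 0 < r / 4 / norm u) by (apply Rdiv_lt_0_compat; lra).
(* Scaling [u] to norm [r / 4] turns the factor [4 * (k + 1) / r] into an image of norm above
   [k + 1]. The surplus 1 is spent on the ball around [x']. *)
assert (Hv' : exists v : V, norm v = r / 4 /\ k + 1 < norm (f v)).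
{ exists (scal (RtoC (r / 4 / norm u)) u); split.
  - rewrite norm_scal_eq by lra; field; lra.
  - assert (E : norm (f (scal (RtoC (r / 4 / norm u)) u))
      = r / 4 / norm u * norm (f u)).
    { refine (eq_trans (f_equal norm (linear_scal f Hf _ _)) _).
      apply norm_scal_eq; lra. }
    rewrite E; apply Rmult_lt_compat_l with (r := r / 4 / norm u) in Hu; [|easy].
    refine (Rle_lt_trans _ _ _ (Req_le _ _ _) Hu); field; lra. }
destruct Hv' as [v [Hv Hfv]].
assert (Hx' : exists x', norm (minus x' x) <= r / 4 /\ k + 1 < norm (f x')).
{ destruct (Rlt_le_dec (k + 1) (norm (f (plus x v)))) as [H1|H1].
  - exists (plus x v); split; [|easy].
    replace (minus (plus x v) x) with v by (module V); lra.
  - exists (minus x v); split.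
    + replace (minus (minus x v) x) with (opp v) by (module V).
      rewrite norm_opp; lra.
    + apply Rnot_le_lt; intros H2.
      assert (E : scal (RtoC 2) (f v) = plus (f (plus x v)) (opp (f (minus x v)))).
      { rewrite (linear_map_minus V W f Hf), (linear_plus f Hf); module W. }
      apply norm_plus_le in E; rewrite norm_opp, norm_scal_eq in E by lra.
      lra. }
destruct Hx' as [x' [H1 H2]].
destruct (linear_map_bound V W f Hf) as [M [HM1 HM2]].
(* The bound [r / 4] keeps the new ball inside the old one, and [/ M] lets [f] vary by at most 1 on
   it. *)
exists x', (Rmin (Rmin (r / 4) (/ M)) e).
assert (HMi : 0 < / M) by now apply Rinv_0_lt_compat.
assert (Ha := Rmin_l (Rmin (r / 4) (/ M)) e).
assert (Hb := Rmin_r (Rmin (r / 4) (/ M)) e).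
assert (Hc' := Rmin_l (r / 4) (/ M)).
assert (Hd := Rmin_r (r / 4) (/ M)).
split; [split; [repeat apply Rmin_glb_lt; lra|lra]|].
split; [lra|]; intros y Hy.
assert (H3 : norm (minus (f y) (f x')) <= 1).
{ rewrite <- (linear_map_minus V W f Hf); apply Rle_trans with (1 := HM2 _).
  rewrite <- (Rinv_r M) by lra; apply Rmult_le_compat_l; lra. }
rewrite norm_sub_sym in H3.
assert (H := norm_plus_le W (f x') (minus (f x') (f y)) (f y) ltac:(module W)).
lra.
Qed.

(** Gliding hump: if no interval [[0, delta]] works, there are nested balls with radii tending to 0
    such that some [F t] with [t <= 1 / (k + 1)] exceeds [k] on the whole of the ball chosen at step
    [k]. Their common point [z] has unbounded values at times arbitrarily close to 0. *)
Lemma uniform_boundedness (V W : C_NormedSpace) (F : R -> V -> W) :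
  seq_complete V ->
  (forall t, 0 <= t -> is_linear (F t)) ->
  (forall x, exists K delta, 0 < delta /\
     forall t, 0 <= t <= delta -> norm (F t x) <= K) ->
  exists K delta, 0 < delta /\
    forall t, 0 <= t <= delta -> forall x, norm (F t x) <= K * norm x.
Proof.
intros HV HF Hpt; apply NNPP; intros Hn.
assert (Hstep : forall q : nat * (V * posreal), exists q' : V * posreal,
  norm (minus (fst q') (fst (snd q))) + snd q' <= snd (snd q) /\
  snd q' <= / INR (S (fst q)) /\
  exists t, 0 <= t <= / INR (S (fst q)) /\
    forall y, norm (minus y (fst q')) <= snd q' -> INR (fst q) < norm (F t y)).
{ intros [k [x r]]; simpl fst; simpl snd.
  assert (Hk : 0 < / INR (S k)) by (apply Rinv_0_lt_compat, lt_0_INR; lia).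
  assert (Ht : exists t u, 0 <= t <= / INR (S k) /\
    4 * (INR k + 1) / r * norm u < norm (F t u)).
  { apply NNPP; intros H; apply Hn.
    exists (4 * (INR k + 1) / r), (/ INR (S k)); split; [easy|].
    intros t Ht u; apply Rnot_lt_le; intros Hu; apply H; now exists t, u. }
  destruct Ht as [t [u [Ht Hu]]].
  destruct (hump_step V W (F t) (INR k) r x u (HF t (proj1 Ht)) (cond_pos r)
    (pos_INR k) Hu _ Hk) as [x' [r' [Hr' [H1 H2]]]].
  exists (x', mkposreal r' (proj1 Hr')); simpl fst; simpl snd; simpl pos.
  split; [easy|split; [easy|]]; now exists t. }
destruct (functional_choice _ Hstep) as [g Hg].
assert (Hs0 : exists s : nat -> V * posreal, forall k, s (S k) = g (k, s k)).
{ exists (fix s (k : nat) : V * posreal := match k with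
    O => (zero, mkposreal 1 Rlt_0_1) | S k' => g (k', s k') end).
  reflexivity. }
destruct Hs0 as [s Hs0].
assert (Hstp : forall k,
  norm (minus (fst (s (S k))) (fst (s k))) + snd (s (S k)) <= snd (s k) /\
  snd (s (S k)) <= / INR (S k) /\
  exists t, 0 <= t <= / INR (S k) /\
    forall y, norm (minus y (fst (s (S k)))) <= snd (s (S k)) ->
      INR k < norm (F t y)).
{ intros k; rewrite Hs0; exact (Hg (k, s k)). }
assert (Hs : forall k m, (k <= m)%nat ->
  norm (minus (fst (s m)) (fst (s k))) + snd (s m) <= snd (s k)).
{ intros k m Hkm; induction Hkm as [|m Hkm IH].
  - replace (minus (fst (s k)) (fst (s k))) with (zero : V) by (module V).
    rewrite norm_zero; lra.
  - destruct (Hstp m) as [H1 _].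
    assert (H := norm_dist_le V (fst (s (S m))) (fst (s m)) (fst (s k))).
    lra. }
destruct (HV (fun k => fst (s k)) (fun k => snd (s k)))
  as [z Hz].
- intros k m Hkm; assert (H := Hs k m Hkm); assert (H' := cond_pos (snd (s m))).
  lra.
- intros eps He; destruct (archimed_cor1 eps He) as [N [H1 H2]].
  exists N; destruct N as [|N]; [lia|].
  destruct (Hstp N) as [_ [H3 _]].
  lra.
- destruct (Hpt z) as [K [d [Hd HK]]].
  destruct (archimed_cor1 d Hd) as [N [H1 H2]].
  destruct (INR_unbounded K) as [N' HN'].
  (* [N] brings the time of the hump below [d], and [N'] brings its height above [K]. *)
  set (k := max N N').
  destruct (Hstp k) as [_ [_ [t [Ht1 Ht2]]]].
  specialize (Ht2 z (Hz (S k))).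
  assert (H3 : / INR (S k) <= / INR N).
  { apply Rinv_le_contravar; [apply lt_0_INR; lia|apply le_INR; lia]. }
  specialize (HK t ltac:(lra)).
  assert (INR N' <= INR k) by (apply le_INR; lia).
  lra.
Qed.

Definition loc_bounded (X : C_NormedSpace) (T : R -> X -> X) : Prop :=
  exists K delta, 0 < K /\ 0 < delta /\
    forall t, 0 <= t <= delta -> forall x, norm (T t x) <= K * norm x.

Lemma semigroup_near_zero (X : C_NormedSpace) (T : R -> X -> X) :
  C0_semigroup T -> forall x eps, 0 < eps -> exists delta, 0 < delta /\
    forall h, 0 <= h < delta -> norm (minus (T h x) x) <= eps.
Proof.
intros (_ & H0 & _ & Hc) x eps He.
destruct (proj1 (filterlim_right_iff X _ _) (Hc x) eps He) as [d [Hd1 Hd2]].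
exists d; split; [easy|]; intros h [[Hh|<-] Hhd]; [now apply Hd2|].
rewrite H0; replace (minus x x) with (zero : X) by (module X).
rewrite norm_zero; lra.
Qed.

(** The difference is [T r] applied to [x - T (s - r) x], which is small by strong continuity at 0.
    What is needed is a bound on [T r] uniform in [r] near [s]: [T r] is factored into the fixed
    operator [T (s - d0)] and a factor whose time lies in the window of local boundedness. *)
Lemma orbit_left_cont (X : C_NormedSpace) (T : R -> X -> X) :
  C0_semigroup T -> loc_bounded X T -> forall x a s, 0 <= a -> 0 < s ->
    left_cont X (fun t => T t x) a s.
Proof.
intros HT (K & d & HK & Hd & Hb) x a s Ha Hs eps He.
assert (HT' := HT); destruct HT' as (Hlin & H0 & Hadd & _).
set (d0 := Rmin d s).
assert (Hd0 : 0 < d0) by now apply Rmin_glb_lt.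
assert (Hd1 : d0 <= d) by apply Rmin_l.
assert (Hd2 : d0 <= s) by apply Rmin_r.
destruct (linear_map_bound X X _ (Hlin (s - d0) ltac:(lra))) as [M [HM1 HM2]].
assert (He' : 0 < eps / (M * K))
  by (apply Rdiv_lt_0_compat; [easy|now apply Rmult_lt_0_compat]).
destruct (semigroup_near_zero X T HT x _ He') as [eta [Heta1 Heta2]].
exists (Rmin eta d0); split; [now apply Rmin_glb_lt|]; intros r Hr Hr2.
assert (Hm1 := Rmin_l eta d0); assert (Hm2 := Rmin_r eta d0).
assert (E : minus (T r x) (T s x)
  = T (s - d0) (T (d0 - (s - r)) (minus x (T (s - r) x)))).
{ rewrite <- Hadd by lra.
  replace (s - d0 + (d0 - (s - r))) with r by ring.
  rewrite (linear_map_minus X X _ (Hlin r ltac:(lra))), <- Hadd by lra.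
  now replace (r + (s - r)) with s by ring. }
rewrite E; apply Rle_trans with (1 := HM2 _).
apply Rle_trans with (M * (K * (eps / (M * K)))); [|right; field; lra].
apply Rmult_le_compat_l; [lra|].
apply Rle_trans with (1 := Hb (d0 - (s - r)) ltac:(lra) _).
apply Rmult_le_compat_l; [lra|]; rewrite norm_sub_sym.
apply Heta2; lra.
Qed.

Lemma orbit_right_cont (X : C_NormedSpace) (T : R -> X -> X) :
  C0_semigroup T -> forall x s eps, 0 <= s -> 0 < eps ->
  exists delta, 0 < delta /\
    forall h, 0 <= h < delta -> norm (minus (T (s + h) x) (T s x)) <= eps.
Proof.
intros HT x s eps Hs He; assert (HT' := HT); destruct HT' as (Hlin & _ & Hadd & _).
destruct (linear_map_bound X X _ (Hlin s Hs)) as [M [HM1 HM2]].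
destruct (semigroup_near_zero X T HT x (eps / M)) as [d [Hd1 Hd2]];
  [now apply Rdiv_lt_0_compat|].
exists d; split; [easy|]; intros h Hh.
rewrite Hadd, <- (linear_map_minus X X _ (Hlin s Hs)) by lra.
apply Rle_trans with (1 := HM2 _).
replace eps with (M * (eps / M)) by (field; lra).
apply Rmult_le_compat_l; [lra|now apply Hd2].
Qed.

Lemma generator_commute (X : C_NormedSpace) (A : LinOp X) (T : R -> X -> X) :
  generates A T -> forall s x, 0 <= s -> dom A x ->
    dom A (T s x) /\ A (T s x) = T s (A x).
Proof.
intros HG s x Hs Hx; apply (generates_iff X A T HG).
destruct (HG) as [(Hlin & H0 & Hadd & _) _].
assert (Hd := proj1 (generates_iff X A T HG x (A x)) (conj Hx eq_refl)).
destruct (linear_map_bound X X _ (Hlin s Hs)) as [M [HM1 HM2]].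
intros eps He; destruct (Hd (eps / M)) as [d [Hd1 Hd2]];
  [now apply Rdiv_lt_0_compat|].
exists d; split; [easy|]; intros h Hh; specialize (Hd2 h Hh).
rewrite Rplus_0_l in Hd2 |- *.
replace (minus (minus (T h (T s x)) (T 0 (T s x))) (scal (RtoC h) (T s (A x))))
  with (T s (minus (minus (T h x) (T 0 x)) (scal (RtoC h) (A x)))).
- apply Rle_trans with (1 := HM2 _).
  replace (eps * h) with (M * (eps / M * h)) by (field; lra).
  apply Rmult_le_compat_l; [lra|easy].
- rewrite !(linear_map_minus X X _ (Hlin s Hs)), !H0, <- !Hadd, (Rplus_comm h) by lra.
  apply (f_equal (minus (minus (T (s + h) x) (T s x)))).
  exact (linear_scal _ (Hlin s Hs) (RtoC h) (A x)).
Qed.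

Lemma orbit_rderiv (X : C_NormedSpace) (A : LinOp X) (T : R -> X -> X) :
  generates A T -> forall s x, 0 <= s -> dom A x ->
    rderiv X (fun t => T t x) s (A (T s x)).
Proof.
intros HG s x Hs Hx.
assert (H := proj1 (generates_iff X A T HG _ _)
  (conj (proj1 (generator_commute X A T HG s x Hs Hx)) eq_refl)).
destruct (HG) as [(_ & H0 & Hadd & _) _].
intros eps He; destruct (H eps He) as [d [Hd1 Hd2]].
exists d; split; [easy|]; intros h Hh; specialize (Hd2 h Hh).
rewrite Rplus_0_l, H0, <- Hadd, (Rplus_comm h) in Hd2 by lra.
exact Hd2.
Qed.

(** * Primitives of continuous functions *)

(** Restriction of scalars from the complex to the real numbers, with the same norm and uniform
    structure, so that the Riemann integral in real normed modules applies. The mixins are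
    transparent, so that their operations convert to those of [V]. *)
Definition real_ModuleSpace_mixin (V : C_NormedSpace) :
  ModuleSpace.mixin_of R_Ring (NormedModule.AbelianGroup C_AbsRing V).
Proof.
apply (ModuleSpace.Mixin R_Ring (NormedModule.AbelianGroup C_AbsRing V)
  (fun (k : R) (x : V) => scal (RtoC k) x)).
- intros x y u; change (scal (RtoC x) (scal (RtoC y) u)
    = scal (RtoC (x * y)) u); module V.
- intros u; exact (scal_one u).
- intros x u v; exact (scal_distr_l (RtoC x) u v).
- intros x y u; change (scal (RtoC (x + y)) u
    = plus (scal (RtoC x) u) (scal (RtoC y) u)); module V.
Defined.

Definition real_NormedModuleAux (V : C_NormedSpace) :
  NormedModuleAux R_AbsRing :=
  NormedModuleAux.Pack R_AbsRing V
    (NormedModuleAux.Class R_AbsRing V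
      (ModuleSpace.Class R_Ring V
        (AbelianGroup.class (NormedModule.AbelianGroup C_AbsRing V))
        (real_ModuleSpace_mixin V))
      (UniformSpace.class (NormedModule.UniformSpace C_AbsRing V))) V.

Definition real_NormedModule_mixin (V : C_NormedSpace) :
  NormedModule.mixin_of R_AbsRing (real_NormedModuleAux V).
Proof.
apply (NormedModule.Mixin R_AbsRing (real_NormedModuleAux V)
  (fun x : V => norm x) (@norm_factor C_AbsRing V)).
- intros x y; exact (norm_triangle (V := V) x y).
- intros l x; exact (norm_scal_le V l x).
- intros x y eps H; exact (norm_compat1 (V := V) x y eps H).
- intros x y eps H; exact (norm_compat2 (V := V) x y eps H).
- intros x H; exact (norm_eq_zero (V := V) x H).
Defined.

Definition real_CompleteNormedModule (V : C_BanachSpace) :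
  CompleteNormedModule R_AbsRing :=
  CompleteNormedModule.Pack R_AbsRing V
    (CompleteNormedModule.Class R_AbsRing V
      (NormedModule.Class R_AbsRing V
        (NormedModuleAux.class R_AbsRing (real_NormedModuleAux V))
        (real_NormedModule_mixin V))
      (CompleteSpace.class (CompleteNormedModule.CompleteSpace C_AbsRing V)))
    V.

Definition norm_continuous (V : C_NormedSpace) (u : R -> V) : Prop :=
  forall s eps, 0 < eps -> exists delta, 0 < delta /\
    forall r, Rabs (r - s) < delta -> norm (minus (u r) (u s)) <= eps.

Definition is_primitive (V : C_NormedSpace) (u I : R -> V) : Prop :=
  I 0 = zero /\
  forall s eps, 0 < eps -> exists delta, 0 < delta /\
    forall h, Rabs h < delta ->
      norm (minus (minus (I (s + h)) (I s)) (scal (RtoC h) (u s)))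
      <= eps * Rabs h.

(** Together with [seq_complete], this is how the Banach property is handed on: the later lemmas can
    then be stated over normed spaces, where the product and its factors have the same type. *)
Definition has_primitives (V : C_NormedSpace) : Prop :=
  forall u : R -> V, norm_continuous V u -> exists I, is_primitive V u I.

Lemma has_primitives_banach (V : C_BanachSpace) : has_primitives V.
Proof.
intros u Hu; set (W := real_CompleteNormedModule V).
assert (Hc : forall s, continuous (u : R -> W) s).
{ intros s.
  apply (proj2 (filterlim_locally_ball_norm (K := R_AbsRing) (U := W) _ _)).
  intros [eps He]; destruct (Hu s (eps / 2)) as [d [Hd1 Hd2]]; [lra|].
  exists (mkposreal d Hd1); intros r Hr.
  refine (Rle_lt_trans _ _ _ (Hd2 r Hr) _); simpl; lra. }
exists (fun t => RInt (u : R -> W) 0 t); split.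
- exact (RInt_point (V := W) 0 _).
- intros s eps He.
  assert (H : is_derive (fun t => RInt (u : R -> W) 0 t) s (u s : W)).
  { apply (is_derive_RInt (V := W) _ _ 0); [|apply Hc].
    apply filter_forall; intros t; apply (RInt_correct (V := W)).
    apply (ex_RInt_continuous (V := W)); intros z _; apply Hc. }
  destruct H as [_ H].
  destruct (H s (fun P HP => HP) (mkposreal eps He)) as [d Hd].
  exists d; split; [apply cond_pos|]; intros h Hh.
  assert (Hball : ball s d (s + h)).
  { change (Rabs (s + h - s) < d); now replace (s + h - s) with h by ring. }
  specialize (Hd (s + h) Hball); simpl in Hd.
  change (norm (minus (minus (RInt (u : R -> W) 0 (s + h) : V)
    (RInt (u : R -> W) 0 s)) (scal (RtoC (s + h - s)) (u s)))
    <= eps * Rabs (s + h - s)) in Hd.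
  replace (s + h - s) with h in Hd by ring.
  exact Hd.
Qed.

(** * Integrals of orbits and density of the domain *)

Lemma is_derive_eps (G : R -> R) (s g : R) :
  is_derive G s g -> forall eps, 0 < eps -> exists delta, 0 < delta /\
    forall h, 0 < h < delta -> Rabs (G (s + h) - G s - h * g) <= eps * h.
Proof.
intros HG eps He; apply is_derive_Reals in HG.
destruct (HG eps He) as [[d Hd] H]; exists d; split; [easy|]; intros h Hh.
assert (Hh0 : h <> 0) by lra.
specialize (H h Hh0); simpl in H; rewrite (Rabs_pos_eq h) in H by lra.
specialize (H ltac:(lra)).
replace (G (s + h) - G s - h * g) with (h * ((G (s + h) - G s) / h - g))
  by (field; lra).
rewrite Rabs_mult, (Rabs_pos_eq h) by lra; rewrite (Rmult_comm eps).
apply Rmult_le_compat_l; lra.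
Qed.

(** [G] is an antiderivative of a bound on the right derivative of [f]; giving it explicitly takes
    the place of integrating a norm. *)
Lemma mean_value (V : C_NormedSpace) (f : R -> V) (G : R -> R) (a b : R) :
  a <= b ->
  (forall s, a < s <= b -> left_cont V f a s) ->
  (forall r s, r <= s -> G r <= G s) ->
  (forall s, a <= s < b -> exists y g,
     rderiv V f s y /\ norm y <= g /\ is_derive G s g) ->
  norm (minus (f b) (f a)) <= G b - G a.
Proof.
intros Hab Hc HG Hd; apply growth_bound; try easy.
intros s eps Hs He; destruct (Hd s Hs) as (y & g & Hy & Hyg & Hg).
destruct (Hy (eps / 2)) as [d1 [Hd1 H1]]; [lra|].
destruct (is_derive_eps G s g Hg (eps / 2)) as [d2 [Hd2 H2]]; [lra|].
exists (Rmin d1 d2); split; [now apply Rmin_glb_lt|]; intros h Hh _.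
assert (Hm1 := Rmin_l d1 d2); assert (Hm2 := Rmin_r d1 d2).
specialize (H1 h ltac:(lra)); specialize (H2 h ltac:(lra)).
assert (H := norm_plus_le V (minus (f (s + h)) (f s))
  (minus (minus (f (s + h)) (f s)) (scal (RtoC h) y)) (scal (RtoC h) y)
  ltac:(module V)).
rewrite (norm_scal_eq V h y) in H by lra.
assert (h * norm y <= h * g) by (apply Rmult_le_compat_l; lra).
apply Rabs_le_between in H2; lra.
Qed.

Lemma rderiv_zero_const (V : C_NormedSpace) (f : R -> V) (t : R) :
  0 <= t -> (forall s, 0 < s <= t -> left_cont V f 0 s) ->
  (forall s, 0 <= s < t -> rderiv V f s zero) -> f t = f 0.
Proof.
intros Ht Hc Hd; apply minus_zero_eq, norm_eq_zero.
apply Rle_antisym; [|apply norm_ge_0].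
assert (H : norm (minus (f t) (f 0)) <= 0 - 0); [|lra].
apply (mean_value V f (fun _ => 0) 0 t Ht Hc); [intros; lra|].
intros s Hs; exists zero, 0; split; [now apply Hd|].
split; [rewrite norm_zero; lra|apply (is_derive_const (V := R_NormedModule))].
Qed.

Lemma rderiv_const (V : C_NormedSpace) (c : V) (s : R) :
  rderiv V (fun _ => c) s zero.
Proof.
intros eps He; exists 1; split; [lra|]; intros h Hh.
assert (E : minus (minus c c) (scal (RtoC h) (zero : V)) = zero)
  by (module V).
refine (Rle_trans _ _ _ (Req_le _ _ (eq_trans (f_equal norm E) norm_zero)) _).
apply Rmult_le_pos; lra.
Qed.

(** Only increments enter, which covers translations in time and additive constants at once. *)
Lemma rderiv_ext (V : C_NormedSpace) (f g : R -> V) (s s' : R) (y : V) :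
  (forall h, 0 < h ->
     minus (f (s + h)) (f s) = minus (g (s' + h)) (g s')) ->
  rderiv V f s y -> rderiv V g s' y.
Proof.
intros E H eps He; destruct (H eps He) as [d [Hd1 Hd2]].
exists d; split; [easy|]; intros h Hh; rewrite <- E by lra; now apply Hd2.
Qed.

Lemma rderiv_minus (V : C_NormedSpace) (f g : R -> V) (s : R) (y z : V) :
  rderiv V f s y -> rderiv V g s z ->
  rderiv V (fun t => minus (f t) (g t)) s (minus y z).
Proof.
intros Hf Hg eps He.
destruct (Hf (eps / 2)) as [d1 [Hd1 H1]]; [lra|].
destruct (Hg (eps / 2)) as [d2 [Hd2 H2]]; [lra|].
exists (Rmin d1 d2); split; [now apply Rmin_glb_lt|]; intros h Hh.
assert (Hm1 := Rmin_l d1 d2); assert (Hm2 := Rmin_r d1 d2).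
specialize (H1 h ltac:(lra)); specialize (H2 h ltac:(lra)).
refine (Rle_trans _ _ _ (norm_minus_le V _
  (minus (minus (f (s + h)) (f s)) (scal (RtoC h) y))
  (minus (minus (g (s + h)) (g s)) (scal (RtoC h) z)) _) _);
  [module V|lra].
Qed.

Lemma rderiv_linear (V W : C_NormedSpace) (L : V -> W) (f : R -> V) (s : R)
    (y : V) :
  is_linear L -> rderiv V f s y -> rderiv W (fun t => L (f t)) s (L y).
Proof.
intros HL Hf eps He.
destruct (linear_map_bound V W L HL) as [M [HM1 HM2]].
destruct (Hf (eps / M)) as [d [Hd1 Hd2]]; [now apply Rdiv_lt_0_compat|].
exists d; split; [easy|]; intros h Hh; specialize (Hd2 h Hh).
replace (minus (minus (L (f (s + h))) (L (f s))) (scal (RtoC h) (L y)))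
  with (L (minus (minus (f (s + h)) (f s)) (scal (RtoC h) y))).
- apply Rle_trans with (1 := HM2 _).
  replace (eps * h) with (M * (eps / M * h)) by (field; lra).
  apply Rmult_le_compat_l; lra.
- rewrite !(linear_map_minus V W L HL).
  apply (f_equal (minus (minus (L (f (s + h))) (L (f s))))).
  exact (linear_scal L HL (RtoC h) y).
Qed.

Lemma left_cont_minus (V : C_NormedSpace) (f g : R -> V) (a s : R) :
  left_cont V f a s -> left_cont V g a s ->
  left_cont V (fun t => minus (f t) (g t)) a s.
Proof.
intros Hf Hg eps He.
destruct (Hf (eps / 2)) as [d1 [Hd1 H1]]; [lra|].
destruct (Hg (eps / 2)) as [d2 [Hd2 H2]]; [lra|].
exists (Rmin d1 d2); split; [now apply Rmin_glb_lt|]; intros r Hr Hr'.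
assert (Hm1 := Rmin_l d1 d2); assert (Hm2 := Rmin_r d1 d2).
specialize (H1 r Hr ltac:(lra)); specialize (H2 r Hr ltac:(lra)).
refine (Rle_trans _ _ _ (norm_minus_le V _
  (minus (f r) (f s)) (minus (g r) (g s)) _) _); [module V|lra].
Qed.

Lemma left_cont_linear (V W : C_NormedSpace) (L : V -> W) (f : R -> V)
    (a s : R) :
  is_linear L -> left_cont V f a s -> left_cont W (fun t => L (f t)) a s.
Proof.
intros HL Hf eps He.
destruct (linear_map_bound V W L HL) as [M [HM1 HM2]].
destruct (Hf (eps / M)) as [d [Hd1 Hd2]]; [now apply Rdiv_lt_0_compat|].
exists d; split; [easy|]; intros r Hr Hr'; specialize (Hd2 r Hr Hr').
rewrite <- (linear_map_minus V W L HL).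
apply Rle_trans with (1 := HM2 _).
replace eps with (M * (eps / M)) by (field; lra).
apply Rmult_le_compat_l; lra.
Qed.

Lemma left_cont_shift (V : C_NormedSpace) (f : R -> V) (a r s : R) :
  left_cont V f (a + r) (s + r) -> left_cont V (fun t => f (t + r)) a s.
Proof.
intros Hf eps He; destruct (Hf eps He) as [d [Hd1 Hd2]].
exists d; split; [easy|]; intros q Hq Hq'; apply Hd2; lra.
Qed.

(** The even extension by [Rabs] makes the orbit continuous on the whole line, as [has_primitives]
    asks, in spite of the arbitrary values of [T] at negative times. *)
Lemma orbit_norm_continuous (X : C_NormedSpace) (T : R -> X -> X) (x : X) :
  C0_semigroup T -> loc_bounded X T ->
  norm_continuous X (fun t => T (Rabs t) x).
Proof.
intros HT Hb s eps He; assert (Hs := Rabs_pos s).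
destruct (orbit_right_cont X T HT x (Rabs s) eps Hs He) as [d1 [Hd1 H1]].
assert (H2 : exists d2, 0 < d2 /\ forall r, 0 <= r < Rabs s ->
  Rabs s - d2 < r -> norm (minus (T r x) (T (Rabs s) x)) <= eps).
{ destruct Hs as [Hs|Hs].
  - destruct (orbit_left_cont X T HT Hb x 0 (Rabs s) (Rle_refl 0) Hs eps He)
      as [d2 [Hd2 H2]].
    exists d2; split; [easy|]; intros r Hr Hr'; apply H2; lra.
  - exists 1; split; [lra|]; intros r Hr; lra. }
destruct H2 as [d2 [Hd2 H2]].
exists (Rmin d1 d2); split; [now apply Rmin_glb_lt|]; intros r Hr.
assert (Hm1 := Rmin_l d1 d2); assert (Hm2 := Rmin_r d1 d2).
assert (Ha := Rabs_triang_inv2 r s); apply Rabs_le_between in Ha.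
assert (Hr0 := Rabs_pos r).
destruct (Rlt_le_dec (Rabs r) (Rabs s)) as [H|H].
- apply H2; lra.
- replace (Rabs r) with (Rabs s + (Rabs r - Rabs s)) by ring; apply H1; lra.
Qed.

(** The function [I t = int_0^t T s x ds]. Its last clause is [T r int_0^t T s x ds = int_r^(t + r)
    T s x ds]. *)
Definition orbit_integral (X : C_NormedSpace) (T : R -> X -> X) (x : X)
    (I : R -> X) : Prop :=
  I 0 = zero /\
  (forall s, 0 <= s -> rderiv X I s (T s x)) /\
  (forall s, left_cont X I 0 s) /\
  (forall r t, 0 <= r -> 0 <= t -> T r (I t) = minus (I (t + r)) (I r)).

Lemma orbit_integral_exists (X : C_NormedSpace) (T : R -> X -> X) (x : X) :
  has_primitives X -> C0_semigroup T -> loc_bounded X T ->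
  exists I, orbit_integral X T x I.
Proof.
intros HX HT Hb.
destruct (HX _ (orbit_norm_continuous X T x HT Hb)) as [I [HI0 HI]].
exists I.
assert (Hd : forall s, 0 <= s -> rderiv X I s (T s x)).
{ intros s Hs eps He; destruct (HI s eps He) as [d [Hd1 Hd2]].
  exists d; split; [easy|]; intros h Hh.
  specialize (Hd2 h); rewrite (Rabs_pos_eq s), (Rabs_pos_eq h) in Hd2 by lra.
  apply Hd2; lra. }
assert (Hc : forall a s, left_cont X I a s).
{ intros a s eps He; destruct (HI s 1 Rlt_0_1) as [d [Hd1 Hd2]].
  set (N := norm (T (Rabs s) x)).
  assert (HN : 0 <= N) by apply norm_ge_0.
  assert (He' : 0 < eps / (N + 1)) by (apply Rdiv_lt_0_compat; lra).
  exists (Rmin d (eps / (N + 1))); split; [now apply Rmin_glb_lt|].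
  intros r Hr Hr'.
  assert (Hm1 := Rmin_l d (eps / (N + 1))).
  assert (Hm2 := Rmin_r d (eps / (N + 1))).
  assert (Ha : Rabs (r - s) = s - r) by (rewrite Rabs_minus_sym; apply Rabs_pos_eq; lra).
  specialize (Hd2 (r - s)); rewrite Ha in Hd2; specialize (Hd2 ltac:(lra)).
  replace (s + (r - s)) with r in Hd2 by ring.
  assert (H := norm_plus_le X (minus (I r) (I s))
    (minus (minus (I r) (I s)) (scal (RtoC (r - s)) (T (Rabs s) x)))
    (scal (RtoC (r - s)) (T (Rabs s) x)) ltac:(module X)).
  assert (H2 := norm_scal_le X (r - s) (T (Rabs s) x)); rewrite Ha in H2.
  fold N in H2.
  assert (H3 : (s - r) * (N + 1) <= eps / (N + 1) * (N + 1))
    by (apply Rmult_le_compat_r; lra).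
  replace (eps / (N + 1) * (N + 1)) with eps in H3 by (field; lra).
  lra. }
split; [easy|split; [easy|split; [easy|]]].
intros r t Hr Ht; destruct (HT) as (Hlin & _ & Hadd & _).
apply minus_zero_eq.
(* No operator is taken under an integral sign: as functions of [t], both terms have the right
   derivative [T (r + t) x], so their difference is constant. *)
assert (E : minus (T r (I t)) (I (t + r)) = minus (T r (I 0)) (I (0 + r))).
{ apply (rderiv_zero_const X (fun t => minus (T r (I t)) (I (t + r))) t Ht).
  - intros s Hs; apply left_cont_minus.
    + apply left_cont_linear; [now apply Hlin|easy].
    + apply left_cont_shift, Hc.
  - intros s Hs.
    replace (zero : X) with (minus (T r (T s x)) (T (s + r) x)).
    + apply rderiv_minus; [apply rderiv_linear; [now apply Hlin|apply Hd; lra]|].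
      apply (rderiv_ext X I _ (s + r)); [|apply Hd; lra].
      intros h Hh; now replace (s + h + r) with (s + r + h) by ring.
    + rewrite <- Hadd, (Rplus_comm r) by lra; module X. }
rewrite Rplus_0_l, HI0, (linear_map_zero X X _ (Hlin r Hr)) in E.
transitivity (plus (minus (T r (I t)) (I (t + r))) (I r)); [module X|].
rewrite E; module X.
Qed.

(** The averages [I h / h] of the orbit tend to [x] as [h] tends to 0, and they lie in the domain
    because [A (I h) = T h x - x]. *)
Lemma generator_dense (X : C_NormedSpace) (A : LinOp X) (T : R -> X -> X) :
  has_primitives X -> generates A T -> loc_bounded X T ->
  forall x eps, 0 < eps -> exists x', dom A x' /\ norm (minus x' x) <= eps.
Proof.
intros HX HG Hb x eps He; destruct (HG) as [HT _].
destruct (orbit_integral_exists X T x HX HT Hb) as [I (HI0 & HI1 & _ & HI3)].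
assert (HT0 : forall x, T 0 x = x) by apply HT.
destruct (HI1 0 (Rle_refl 0) eps He) as [d [Hd1 Hd2]].
set (h := d / 2); specialize (Hd2 h ltac:(unfold h; lra)).
assert (Hh : 0 < h) by (unfold h; lra).
assert (Hhi : 0 < / h) by now apply Rinv_0_lt_compat.
exists (scal (RtoC (/ h)) (I h)); split.
- apply dom_scal.
  refine (proj1 (proj2 (generates_iff X A T HG (I h) (minus (T h x) (T 0 x))) _)).
  apply (rderiv_ext X (fun r => minus (I (r + h)) (I r)) _ 0).
  + intros r Hr; rewrite !Rplus_0_l, HT0, HI3, HI0, (Rplus_comm r) by lra.
    module X.
  + apply rderiv_minus; [|apply HI1; lra].
    apply (rderiv_ext X I _ h); [|apply HI1; lra].
    intros r Hr; now rewrite !Rplus_0_l, (Rplus_comm h).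
- rewrite Rplus_0_l, HI0, HT0 in Hd2.
  assert (E : minus (scal (RtoC (/ h)) (I h)) x =
    scal (RtoC (/ h)) (minus (minus (I h) zero) (scal (RtoC h) x)))
    by (module X; field; lra).
  refine (Rle_trans _ _ _ (Req_le _ _ (f_equal norm E)) _).
  rewrite norm_scal_eq by lra; apply Rinv_mult_cancel; [lra|exact Hd2].
Qed.

(** * Resolvents of exponentially stable semigroups *)

(** Preimages are picked by choice; injectivity forces the resulting map to be linear, and the norm
    bound makes it bounded. *)
Lemma bounded_inverse_of_bijective (X : C_NormedSpace) (A : LinOp X) (M : R) :
  0 < M -> (forall x, dom A x -> A x = zero -> x = zero) ->
  (forall x, exists v, dom A v /\ A v = x /\ norm v <= M * norm x) ->
  exists S, bounded_inverse A S.
Proof.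
intros HM Hinj Hsurj.
destruct (functional_choice _ Hsurj) as [S HS].
assert (Huniq : forall u v, dom A u -> dom A v -> A u = A v -> u = v).
{ intros u v Hu Hv E; apply minus_zero_eq.
  replace (minus u v) with (plus u (scal (RtoC (-1)) v)) by (module X).
  apply Hinj.
  - apply dom_plus; [easy|now apply dom_scal].
  - rewrite op_plus, op_scal, E; [module X|easy|easy|now apply dom_scal]. }
exists S; split; [split|split].
- intros x y; destruct (HS x) as (H1 & H2 & _), (HS y) as (H3 & H4 & _).
  destruct (HS (plus x y)) as (H5 & H6 & _).
  apply Huniq; [easy|now apply dom_plus|].
  now rewrite op_plus, H2, H4, H6.
- intros k x; destruct (HS x) as (H1 & H2 & _), (HS (scal k x)) as (H5 & H6 & _).
  apply Huniq; [easy|now apply dom_scal|].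
  refine (eq_trans H6 (eq_sym (eq_trans (op_scal k H1) _))).
  now rewrite H2.
- exists M; split; [easy|]; intros x; apply HS.
- intros x; destruct (HS x) as (H1 & H2 & _); now split.
- intros x Hx; destruct (HS (A x)) as (H1 & H2 & _); now apply Huniq.
Qed.

Lemma bounded_inverse_shift_zero (X : C_NormedSpace) (A : LinOp X) (S : X -> X) :
  bounded_inverse (shift (RtoC 0) A) S -> bounded_inverse A (fun x => opp (S x)).
Proof.
intros [HS [H1 H2]].
assert (Hop : forall x, opp (S x) = S (scal (RtoC (-1)) x)).
{ intros x; refine (eq_trans _ (eq_sym (linear_scal S HS _ _))); module X. }
split; [split|split].
- intros x y; rewrite (linear_plus S HS); module X.
- intros k x; refine (eq_trans (f_equal opp (linear_scal S HS k x)) _); module X.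
- destruct (linear_map_bound X X S HS) as [M [HM1 HM2]].
  exists M; split; [easy|]; intros x; rewrite norm_opp; apply HM2.
- intros x; rewrite Hop; destruct (H1 (scal (RtoC (-1)) x)) as [H3 H4].
  split; [exact H3|]; simpl in H4.
  set (v := S (scal (RtoC (-1)) x)) in *.
  transitivity (scal (RtoC (-1)) (minus (scal (RtoC 0) v) (A v)));
    [module X|rewrite H4; module X].
- intros x Hx; rewrite Hop; rewrite <- (H2 x Hx) at 2; apply (f_equal S).
  simpl; module X.
Qed.

Lemma exp_eventually_small (M omega eps : R) :
  0 < omega -> 0 < eps -> exists N : nat, forall t, INR N <= t ->
    M * exp (- omega * t) <= eps.
Proof.
intros Hw He; destruct (INR_unbounded (Rabs M / (omega * eps))) as [N HN].
exists N; intros t Ht.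
assert (HM := Rabs_pos M).
assert (Hq : 0 <= Rabs M / (omega * eps)).
{ apply Rmult_le_pos; [easy|]; apply Rlt_le, Rinv_0_lt_compat.
  now apply Rmult_lt_0_compat. }
assert (Hwt : 0 < omega * t) by (apply Rmult_lt_0_compat; lra).
assert (H1 : omega * t < exp (omega * t)).
{ assert (H := exp_ineq1 (omega * t) ltac:(lra)); lra. }
replace (- omega * t) with (- (omega * t)) by ring; rewrite exp_Ropp.
apply Rmult_le_reg_r with (exp (omega * t)); [apply exp_pos|].
rewrite Rmult_assoc, Rinv_l, Rmult_1_r by (assert (H := exp_pos (omega * t)); lra).
apply Rle_trans with (Rabs M); [apply Rle_abs|].
apply Rle_trans with (eps * (omega * t)); [|apply Rmult_le_compat_l; lra].
replace (Rabs M) with (Rabs M / (omega * eps) * (omega * eps)) by (field; lra).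
replace (eps * (omega * t)) with (t * (omega * eps)) by ring.
apply Rmult_le_compat_r; [apply Rlt_le, Rmult_lt_0_compat; lra|lra].
Qed.

Lemma is_derive_exp_scal (c k s : R) :
  is_derive (fun t => c * exp (k * t)) s (c * k * exp (k * s)).
Proof. auto_derive; [easy|ring]. Qed.

Lemma exp_decreasing (omega r s : R) :
  0 < omega -> r <= s -> exp (- omega * s) <= exp (- omega * r).
Proof.
intros Hw [H| ->]; [|lra]; apply Rlt_le, exp_increasing.
rewrite !Ropp_mult_distr_l_reverse; apply Ropp_lt_contravar.
now apply Rmult_lt_compat_l.
Qed.

Definition bounded_by (X : C_NormedSpace) (T : R -> X -> X) (m : R -> R) : Prop :=
  forall t, 0 <= t -> forall x, norm (T t x) <= m t * norm x.

Lemma exp_le_one (omega t : R) : 0 < omega -> 0 <= t -> exp (- omega * t) <= 1.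
Proof.
intros Hw Ht; rewrite <- exp_0; replace 0 with (- omega * 0) by ring.
now apply exp_decreasing.
Qed.

Lemma bounded_by_exp_const (X : C_NormedSpace) (T : R -> X -> X) (M omega : R) :
  0 < M -> 0 < omega -> bounded_by X T (fun t => M * exp (- omega * t)) ->
  bounded_by X T (fun _ => M).
Proof.
intros HM Hw H t Ht x; apply Rle_trans with (1 := H t Ht x).
apply Rmult_le_compat_r; [apply norm_ge_0|].
rewrite <- (Rmult_1_r M) at 2; apply Rmult_le_compat_l; [lra|].
now apply exp_le_one.
Qed.

Lemma bounded_by_const_loc (X : C_NormedSpace) (T : R -> X -> X) (K : R) :
  0 < K -> bounded_by X T (fun _ => K) -> loc_bounded X T.
Proof.
intros HK H; exists K, 1; split; [easy|split; [lra|]]; intros t Ht x.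
apply H; lra.
Qed.

(* The inverse of minus the generator is the improper integral of the
   semigroup. *)
Lemma exp_stable_inverse (X : C_NormedSpace) (A : LinOp X) (T : R -> X -> X)
    (M omega : R) :
  seq_complete X -> has_primitives X -> C0_semigroup T ->
  (forall x y, (dom A x /\ A x = y) <-> rderiv X (fun t => T t x) 0 (opp y)) ->
  0 < M -> 0 < omega -> bounded_by X T (fun t => M * exp (- omega * t)) ->
  exists S, bounded_inverse A S.
Proof.
intros HX1 HX2 HT HG HM Hw Hb.
assert (Hl := bounded_by_const_loc X T M HM
  (bounded_by_exp_const X T M omega HM Hw Hb)).
destruct (HT) as (Hlin & H0 & Hadd & _).
assert (HMw : 0 < M / omega) by now apply Rdiv_lt_0_compat.
apply (bounded_inverse_of_bijective X A (M / omega) HMw).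
(* A vector in the kernel has a constant orbit, and this orbit decays. *)
- intros x Hx HAx.
  assert (Hd0 : rderiv X (fun t => T t x) 0 zero).
  { replace (zero : X) with (opp zero : X) by (module X).
    now apply HG. }
  assert (Hd : forall s, 0 <= s -> rderiv X (fun t => T t x) s zero).
  { intros s Hs; rewrite <- (linear_map_zero X X (T s) (Hlin s Hs)).
    apply (rderiv_linear X X (T s)) in Hd0; [|now apply Hlin].
    revert Hd0; apply rderiv_ext; intros h Hh.
    now rewrite Rplus_0_l, <- !Hadd, Rplus_0_r by lra. }
  assert (Hconst : forall t, 0 <= t -> T t x = x).
  { intros t Ht; rewrite <- (H0 x) at 2.
    apply (rderiv_zero_const X (fun t => T t x) t Ht).
    - intros s Hs; apply orbit_left_cont; try easy; lra.
    - intros s Hs; apply Hd; lra. }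
  apply small_norm_zero; intros eps He.
  destruct (exp_eventually_small (M * norm x) omega eps Hw He) as [N HN].
  rewrite <- (Hconst (INR N) (pos_INR N)).
  apply Rle_trans with (1 := Hb _ (pos_INR N) x).
  specialize (HN (INR N) (Rle_refl _)); lra.
- intros x.
  destruct (orbit_integral_exists X T x HX2 HT Hl) as [I (HI0 & HI1 & HI2 & HI3)].
  (* [K * exp (- omega * a)] is the integral of [M * exp (- omega * s) * norm x] over [s >= a]. *)
  set (K := M / omega * norm x).
  assert (HK : 0 <= K)
    by (apply Rmult_le_pos; [lra|apply norm_ge_0]).
  assert (Htail : forall a b, 0 <= a <= b ->
    norm (minus (I b) (I a)) <= K * exp (- omega * a)).
  { intros a b Hab.
    apply Rle_trans with
      (- K * exp (- omega * b) - - K * exp (- omega * a)).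
    - apply (mean_value X I (fun t => - K * exp (- omega * t))); [lra| | |].
      + intros s Hs eps He; destruct (HI2 s eps He) as [d [Hd1 Hd2]].
        exists d; split; [easy|]; intros r Hr; apply Hd2; lra.
      + intros r s Hrs.
        assert (H := Rmult_le_compat_l K _ _ HK (exp_decreasing omega r s Hw Hrs)).
        lra.
      + intros s Hs; exists (T s x), (- K * - omega * exp (- omega * s)).
        split; [apply HI1; lra|split; [|apply is_derive_exp_scal]].
        apply Rle_trans with (1 := Hb s ltac:(lra) x); right; unfold K.
        field; lra.
    - assert (0 <= K * exp (- omega * b)); [|lra].
      apply Rmult_le_pos; [easy|apply Rlt_le, exp_pos]. }
  destruct (HX1 (fun n => I (INR n)) (fun n => K * exp (- omega * INR n)))
    as [v Hv].
  + intros k m Hkm; apply Htail; split; [apply pos_INR|now apply le_INR].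
  + intros eps He; destruct (exp_eventually_small K omega eps Hw He) as [N HN].
    exists N; now apply HN, Rle_refl.
  (* Here [v] is the integral over all positive times. The identity holds with [I N] in place of [v]
     up to the error [I (N + r) - I N]. The three tails contribute [L * K], [K] and [K] times
     [exp (- omega * N)]. *)
  + assert (HTv : forall r, 0 <= r -> minus (T r v) v = opp (I r)).
    { intros r Hr; apply minus_zero_eq, small_norm_zero; intros eps He.
      destruct (linear_map_bound X X _ (Hlin r Hr)) as [L [HL1 HL2]].
      destruct (exp_eventually_small (L * K + K + K) omega eps Hw He) as [N HN].
      specialize (HN (INR N) (Rle_refl _)).
      set (e := exp (- omega * INR N)) in *.
      assert (H1 : norm (T r (minus v (I (INR N)))) <= L * (K * e)).
      { apply Rle_trans with (1 := HL2 _); apply Rmult_le_compat_l; [lra|].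
        apply Hv. }
      assert (H2 := Hv N); fold e in H2.
      assert (HN0 := pos_INR N).
      assert (H3 := Htail (INR N) (INR N + r) ltac:(lra)); fold e in H3.
      assert (H4 := norm_plus_le X (minus (minus (T r v) v) (opp (I r)))
        (minus (T r (minus v (I (INR N)))) (minus v (I (INR N))))
        (minus (I (INR N + r)) (I (INR N)))).
      rewrite (linear_map_minus X X _ (Hlin r Hr)) in H1, H4.
      rewrite (HI3 r (INR N) Hr HN0) in H1, H4.
      specialize (H4 ltac:(module X)).
      assert (H5 := norm_minus_le X (minus (minus (T r v)
        (minus (I (INR N + r)) (I r))) (minus v (I (INR N)))) _ _ eq_refl).
      lra. }
    assert (HAv : dom A v /\ A v = x).
    { apply HG.
      replace (opp x) with (minus zero (T 0 x)) by (rewrite H0; module X).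
      apply (rderiv_ext X (fun r => minus zero (I r)) _ 0).
      - intros h Hh; rewrite HI0, Rplus_0_l, H0, HTv by lra; module X.
      - apply rderiv_minus; [|apply HI1; lra].
        apply rderiv_const. }
    exists v; split; [easy|split; [easy|]].
    (* The tail bound at index 0 is the required bound on the norm of [v]. *)
    specialize (Hv O); simpl in Hv; rewrite Rmult_0_r, exp_0, Rmult_1_r, HI0 in Hv.
    replace v with (minus v zero) by (module X); exact Hv.
Qed.

(* [exp (- i w t)] *)
Definition rot (w t : R) : C := (cos (w * t), - sin (w * t)).

Lemma rot_plus (w s t : R) : rot w (s + t) = (rot w s * rot w t)%C.
Proof.
unfold rot; rewrite Rmult_plus_distr_l, cos_plus, sin_plus.
apply injective_projections; simpl; ring.
Qed.

Lemma rot_zero (w : R) : rot w 0 = RtoC 1.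
Proof.
unfold rot; rewrite Rmult_0_r, cos_0, sin_0, Ropp_0; reflexivity.
Qed.

Lemma rot_inverse (w t : R) : (rot (- w) t * rot w t)%C = RtoC 1.
Proof.
unfold rot; rewrite Ropp_mult_distr_l_reverse, cos_neg, sin_neg.
assert (H := sin2_cos2 (w * t)); unfold Rsqr in H.
apply injective_projections; simpl; [rewrite <- H|]; ring.
Qed.

Lemma norm_scal_C_le (V : C_NormedSpace) (k : C) (x : V) :
  norm (scal k x) <= Cmod k * norm x.
Proof. exact (norm_scal k x). Qed.

Lemma Cmod_rot (w t : R) : Cmod (rot w t) = 1.
Proof.
unfold Cmod, rot; simpl; refine (eq_trans _ sqrt_1); f_equal.
assert (H := sin2_cos2 (w * t)); unfold Rsqr in H.
refine (eq_trans _ H); ring.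
Qed.

Lemma norm_rot (V : C_NormedSpace) (w t : R) (x : V) :
  norm (scal (rot w t) x) <= norm x.
Proof.
rewrite <- (Rmult_1_l (norm x)), <- (Cmod_rot w t); apply norm_scal_C_le.
Qed.

Lemma Cmod_le_sum (a b : R) : Cmod (a, b) <= Rabs a + Rabs b.
Proof.
replace ((a, b) : C) with (RtoC a + (0, b))%C
  by (apply injective_projections; simpl; ring).
apply Rle_trans with (1 := Cmod_triangle _ _).
rewrite Cmod_R; apply Rplus_le_compat_l.
unfold Cmod; simpl; right; rewrite <- sqrt_Rsqr_abs; f_equal; unfold Rsqr; ring.
Qed.

Lemma rot_derive_zero (w eps : R) : 0 < eps -> exists delta, 0 < delta /\
  forall h, 0 < h < delta ->
    Cmod (rot w h - RtoC 1 + RtoC h * (0%R, w))%C <= eps * h.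
Proof.
intros He.
destruct (is_derive_eps (fun t => cos (w * t)) 0 0) with (eps := eps / 2)
  as [d1 [Hd1 H1]]; [auto_derive; [easy|rewrite Rmult_0_r, sin_0; ring]|lra|].
destruct (is_derive_eps (fun t => sin (w * t)) 0 w) with (eps := eps / 2)
  as [d2 [Hd2 H2]]; [auto_derive; [easy|rewrite Rmult_0_r, cos_0; ring]|lra|].
exists (Rmin d1 d2); split; [now apply Rmin_glb_lt|]; intros h Hh.
assert (Hm1 := Rmin_l d1 d2); assert (Hm2 := Rmin_r d1 d2).
specialize (H1 h ltac:(lra)); specialize (H2 h ltac:(lra)).
rewrite Rplus_0_l, Rmult_0_r in H1, H2; rewrite cos_0 in H1; rewrite sin_0 in H2.
replace (rot w h - RtoC 1 + RtoC h * (0%R, w))%C with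
  ((cos (w * h) - 1 - h * 0, - (sin (w * h) - 0 - h * w)) : C)
  by (unfold rot; apply injective_projections; simpl; ring).
apply Rle_trans with (1 := Cmod_le_sum _ _); rewrite Rabs_Ropp; lra.
Qed.

Lemma rot_near_one (w eps : R) : 0 < eps -> exists delta, 0 < delta /\
  forall h, 0 < h < delta -> Cmod (rot w h - RtoC 1)%C <= eps.
Proof.
intros He; destruct (rot_derive_zero w 1 Rlt_0_1) as [d [Hd1 Hd2]].
assert (Hw := Rabs_pos w).
assert (He' : 0 < eps / (1 + Rabs w)) by (apply Rdiv_lt_0_compat; lra).
exists (Rmin d (eps / (1 + Rabs w))); split; [now apply Rmin_glb_lt|].
intros h Hh.
assert (Hm1 := Rmin_l d (eps / (1 + Rabs w))).
assert (Hm2 := Rmin_r d (eps / (1 + Rabs w))).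
specialize (Hd2 h ltac:(lra)).
replace (rot w h - RtoC 1)%C with
  ((rot w h - RtoC 1 + RtoC h * (0%R, w)) + (0%R, (- (h * w))%R))%C
  by (apply injective_projections; simpl; ring).
apply Rle_trans with (1 := Cmod_triangle _ _).
assert (H := Cmod_le_sum 0 (- (h * w))).
rewrite Rabs_R0, Rabs_Ropp, Rabs_mult, (Rabs_pos_eq h) in H by lra.
apply Rle_trans with (h * (1 + Rabs w)); [lra|].
apply Rle_trans with (eps / (1 + Rabs w) * (1 + Rabs w));
  [apply Rmult_le_compat_r; lra|right; field; lra].
Qed.

(** Product rule at 0, where [rot w] has the derivative [- i w] and [(0, w)] is [i w]. The three
    errors are the remainder of [u], the change of [rot w] acting on [y], and the remainder of
    [rot w] acting on [u 0]. *)
Lemma rderiv_rot (V : C_NormedSpace) (u : R -> V) (w : R) (y : V) :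
  rderiv V u 0 y ->
  rderiv V (fun t => scal (rot w t) (u t)) 0
    (minus y (scal ((0%R, w) : C) (u 0))).
Proof.
intros Hu eps He.
set (N := norm y + norm (u 0) + 1).
assert (HN1 := norm_ge_0 y); assert (HN2 := norm_ge_0 (u 0)).
set (e := eps / (2 * N)).
assert (HeN : 0 < e) by (apply Rdiv_lt_0_compat; unfold N; lra).
destruct (Hu (eps / 2)) as [d1 [Hd1 H1]]; [lra|].
destruct (rot_derive_zero w e HeN) as [d2 [Hd2 H2]].
destruct (rot_near_one w e HeN) as [d3 [Hd3 H3]].
exists (Rmin d1 (Rmin d2 d3)); split; [repeat apply Rmin_glb_lt; easy|].
intros h Hh.
assert (Hm1 := Rmin_l d1 (Rmin d2 d3)); assert (Hm2 := Rmin_r d1 (Rmin d2 d3)).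
assert (Hm3 := Rmin_l d2 d3); assert (Hm4 := Rmin_r d2 d3).
specialize (H1 h ltac:(lra)); specialize (H2 h ltac:(lra)).
specialize (H3 h ltac:(lra)); cbv beta.
rewrite Rplus_0_l in H1 |- *; rewrite rot_zero.
set (c2 := (rot w h - RtoC 1 + RtoC h * (0%R, w))%C) in *.
set (c1 := (rot w h - RtoC 1)%C) in *.
assert (H4 := norm_rot V w h (minus (minus (u h) (u 0)) (scal (RtoC h) y))).
assert (H5 : norm (scal (RtoC h) (scal c1 y)) <= h * (e * norm y)).
{ rewrite norm_scal_eq by lra; apply Rmult_le_compat_l; [lra|].
  apply Rle_trans with (1 := norm_scal_C_le V _ _).
  apply Rmult_le_compat_r; lra. }
assert (H6 : norm (scal c2 (u 0)) <= e * h * norm (u 0)).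
{ apply Rle_trans with (1 := norm_scal_C_le V _ _).
  apply Rmult_le_compat_r; lra. }
assert (E : minus (minus (scal (rot w h) (u h)) (scal (RtoC 1) (u 0)))
    (scal (RtoC h) (minus y (scal ((0%R, w) : C) (u 0))))
  = plus (scal (rot w h) (minus (minus (u h) (u 0)) (scal (RtoC h) y)))
      (plus (scal (RtoC h) (scal c1 y)) (scal c2 (u 0))))
  by (unfold c1, c2; module V).
refine (Rle_trans _ _ _ (norm_plus3_le V _ _ _ _ E) _).
assert (H8 : e * h * (norm y + norm (u 0)) <= e * h * N)
  by (apply Rmult_le_compat_l; [apply Rmult_le_pos|unfold N]; lra).
replace (e * h * N) with (eps * h / 2) in H8 by (unfold e; field; unfold N; lra).
lra.
Qed.

(** The rotated semigroup [exp (- i w t) T t] has the generator [A - i w] and the same decay, so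
    [exp_stable_inverse] inverts [i w - A]. *)
Lemma exp_stable_resolvent (X : C_NormedSpace) (A : LinOp X) (T : R -> X -> X)
    (M omega : R) :
  seq_complete X -> has_primitives X -> generates A T ->
  0 < M -> 0 < omega -> bounded_by X T (fun t => M * exp (- omega * t)) ->
  forall w, resolvent_set A (0, w).
Proof.
intros HX1 HX2 HG HM Hw Hb w; destruct (HG) as [(Hlin & H0 & Hadd & Hc) _].
apply (exp_stable_inverse X (shift (0%R, w) A) (fun t x => scal (rot w t) (T t x))
  M omega HX1 HX2); try easy.
- split; [|split; [|split]].
  + intros t Ht; specialize (Hlin t Ht); split.
    * intros x y; rewrite (linear_plus _ Hlin); module X.
    * intros k x.
      refine (eq_trans (f_equal (scal (rot w t)) (linear_scal _ Hlin k x)) _).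
      module X.
    * destruct (linear_map_bound X X _ Hlin) as [L [HL1 HL2]].
      exists L; split; [easy|]; intros x.
      apply Rle_trans with (1 := norm_rot X w t _); apply HL2.
  + intros x; rewrite H0, rot_zero; module X.
  + intros s t x Hs Ht; rewrite Hadd, rot_plus by easy.
    refine (eq_trans _ (f_equal (scal (rot w s))
      (eq_sym (linear_scal _ (Hlin s Hs) _ _)))); module X.
  + intros x; apply filterlim_right_iff; intros eps He.
    assert (Hx := norm_ge_0 x).
    destruct (proj1 (filterlim_right_iff X _ _) (Hc x) (eps / 2))
      as [d1 [Hd1 H1]]; [lra|].
    destruct (rot_near_one w (eps / (2 * (norm x + 1)))) as [d2 [Hd2 H2]];
      [apply Rdiv_lt_0_compat; lra|].
    exists (Rmin d1 d2); split; [now apply Rmin_glb_lt|]; intros h Hh.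
    assert (Hm1 := Rmin_l d1 d2); assert (Hm2 := Rmin_r d1 d2).
    specialize (H1 h ltac:(lra)); specialize (H2 h ltac:(lra)).
    assert (E : minus (scal (rot w h) (T h x)) x = plus
      (scal (rot w h) (minus (T h x) x)) (scal (rot w h - RtoC 1)%C x))
      by (module X).
    refine (Rle_trans _ _ _ (norm_plus_le X _ _ _ E) _).
    assert (H3 := norm_rot X w h (minus (T h x) x)).
    assert (H4 := norm_scal_C_le X (rot w h - RtoC 1)%C x).
    assert (H5 : Cmod (rot w h - RtoC 1) * norm x
      <= eps / (2 * (norm x + 1)) * (norm x + 1)).
    { apply Rmult_le_compat; [apply Cmod_ge_0|easy|easy|lra]. }
    replace (eps / (2 * (norm x + 1)) * (norm x + 1)) with (eps / 2) in H5
      by (field; lra).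
    lra.
- intros x y; split.
  + intros [Hx Hy]; simpl in Hx, Hy.
    assert (H := proj1 (generates_iff X A T HG x (A x)) (conj Hx eq_refl)).
    apply (rderiv_rot X _ w) in H; rewrite H0 in H.
    replace (opp y) with (minus (A x) (scal ((0%R, w) : C) x));
      [exact H|rewrite <- Hy; module X].
  (* Rotating back by [- w] recovers the orbit of [T] itself. *)
  + intros H; apply (rderiv_rot X _ (- w)) in H.
    apply (rderiv_ext X _ (fun t => T t x) 0 0) in H.
    * apply (generates_iff X A T HG) in H; destruct H as [Hx Hy].
      split; [exact Hx|]; simpl; rewrite Hy, H0, rot_zero; module X.
    * intros h _.
      assert (E : forall t, scal (rot (- w) t) (scal (rot w t) (T t x)) = T t x).
      { intros t; transitivity (scal (rot (- w) t * rot w t)%C (T t x));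
          [module X|rewrite rot_inverse; module X]. }
      now rewrite !E.
- intros t Ht x; apply Rle_trans with (1 := norm_rot X w t _); now apply Hb.
Qed.

Lemma resolvent_zero_inverse (X : C_NormedSpace) (A : LinOp X) :
  resolvent_set A (0, 0) -> exists S, bounded_inverse A S.
Proof.
intros [S HS]; exists (fun x => opp (S x)).
exact (bounded_inverse_shift_zero X A S HS).
Qed.

(** * Norm of the product and the triangular resolvent *)

Lemma norm_fst_le (X1 X2 : C_NormedSpace)
    (x : prod_NormedModule C_AbsRing X1 X2) : norm (fst x) <= norm x.
Proof.
change (norm x) with (sqrt (norm (fst x) ^ 2 + norm (snd x) ^ 2)).
rewrite <- (sqrt_pow2 (norm (fst x))) at 1 by apply norm_ge_0.
apply sqrt_le_1_alt; assert (H := pow2_ge_0 (norm (snd x))); lra.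
Qed.

Lemma norm_snd_le (X1 X2 : C_NormedSpace)
    (x : prod_NormedModule C_AbsRing X1 X2) : norm (snd x) <= norm x.
Proof.
change (norm x) with (sqrt (norm (fst x) ^ 2 + norm (snd x) ^ 2)).
rewrite <- (sqrt_pow2 (norm (snd x))) at 1 by apply norm_ge_0.
apply sqrt_le_1_alt; assert (H := pow2_ge_0 (norm (fst x))); lra.
Qed.

Lemma norm_pair_le (X1 X2 : C_NormedSpace)
    (x : prod_NormedModule C_AbsRing X1 X2) : norm x <= norm (fst x) + norm (snd x).
Proof.
change (norm x) with (sqrt (norm (fst x) ^ 2 + norm (snd x) ^ 2)).
assert (H1 := norm_ge_0 (fst x)); assert (H2 := norm_ge_0 (snd x)).
rewrite <- (sqrt_pow2 (norm (fst x) + norm (snd x))) by lra.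
apply sqrt_le_1_alt.
assert (H := Rmult_le_pos _ _ H1 H2); ring_simplify; lra.
Qed.

(** Back substitution: the second row gives [v2 = S2 (snd x)], and the first then reads
    [(lambda - A1) v1 = fst x + B (C v2)]. *)
Lemma resolvent_block (X1 X2 Y : C_NormedSpace) (A1 : LinOp X1)
    (A2 : LinOp X2) (B : Y -> X1) (C : X2 -> Y)
    (hB : is_linear B) (hC : is_linear C) (lambda : Complex.C) :
  resolvent_set A1 lambda -> resolvent_set A2 lambda ->
  resolvent_set (block_op A1 A2 hB hC) lambda.
Proof.
intros [S1 (L1 & D1 & E1)] [S2 (L2 & D2 & E2)].
destruct (linear_map_bound _ _ _ L1) as [M1 [HM1 HM1']].
destruct (linear_map_bound _ _ _ L2) as [M2 [HM2 HM2']].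
destruct (linear_map_bound _ _ _ hB) as [MB [HMB HMB']].
destruct (linear_map_bound _ _ _ hC) as [MC [HMC HMC']].
set (D := fun x2 => B (C (S2 x2))).
assert (hDp : forall x y, D (plus x y) = plus (D x) (D y)).
{ intros x y; unfold D.
  now rewrite (linear_plus _ L2), (linear_plus _ hC), (linear_plus _ hB). }
assert (hDs : forall k x, D (scal k x) = scal k (D x)).
{ intros k x; unfold D.
  refine (eq_trans (f_equal (fun v => B (C v)) (linear_scal _ L2 k x)) _).
  refine (eq_trans (f_equal B (linear_scal _ hC k _)) _).
  exact (linear_scal _ hB k _). }
assert (hDn : forall x, norm (D x) <= MB * (MC * M2) * norm x).
{ intros x; unfold D; apply Rle_trans with (1 := HMB' _).
  rewrite Rmult_assoc; apply Rmult_le_compat_l; [lra|].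
  apply Rle_trans with (1 := HMC' _).
  rewrite Rmult_assoc; apply Rmult_le_compat_l; [lra|apply HM2']. }
exists (fun x : prod_NormedModule C_AbsRing X1 X2 => (S1 (plus (fst x) (D (snd x))), S2 (snd x))).
split; [split|split].
- intros [x1 x2] [y1 y2].
  refine (f_equal2 pair _ (linear_plus _ L2 x2 y2)).
  refine (eq_trans _ (linear_plus _ L1 _ _)); apply f_equal; simpl.
  rewrite hDp; module X1.
- intros k [x1 x2].
  refine (f_equal2 pair _ (linear_scal _ L2 k x2)).
  refine (eq_trans _ (linear_scal _ L1 _ _)); apply f_equal; simpl.
  refine (eq_trans (f_equal (plus _) (hDs k x2)) _); module X1.
- assert (HP : 0 < MB * (MC * M2)) by (repeat apply Rmult_lt_0_compat; easy).
  exists (M1 * (1 + MB * (MC * M2)) + M2); split.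
  { apply Rplus_lt_0_compat; [apply Rmult_lt_0_compat|]; lra. }
  intros x; apply Rle_trans with (1 := norm_pair_le X1 X2 _); simpl fst; simpl snd.
  assert (H1 := norm_fst_le X1 X2 x); assert (H2 := norm_snd_le X1 X2 x).
  rewrite Rmult_plus_distr_r; apply Rplus_le_compat.
  + apply Rle_trans with (1 := HM1' _); rewrite Rmult_assoc.
    apply Rmult_le_compat_l; [lra|].
    apply Rle_trans with (1 := norm_triangle _ _).
    assert (H3 := hDn (snd x)).
    assert (MB * (MC * M2) * norm (snd x) <= MB * (MC * M2) * norm x)
      by (apply Rmult_le_compat_l; lra).
    lra.
  + apply Rle_trans with (1 := HM2' _); apply Rmult_le_compat_l; lra.
- intros [x1 x2]; simpl fst; simpl snd.
  destruct (D1 (plus x1 (D x2))) as [H1 H2], (D2 x2) as [H3 H4].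
  split; [split; [exact H1|exact H3]|].
  refine (f_equal2 pair _ H4); simpl in H2 |- *.
  set (v := S1 (plus x1 (D x2))) in *; fold (D x2).
  transitivity (minus (minus (scal lambda v) (A1 v)) (D x2));
    [|rewrite H2]; module X1.
- intros [x1 x2] [H1 H2]; simpl in H1, H2.
  assert (H3 := E2 x2 H2); refine (f_equal2 pair _ H3); simpl.
  rewrite <- (E1 x1 H1) at 3; apply f_equal; simpl.
  unfold D; simpl in H3.
  transitivity (plus (minus (scal lambda x1) (plus (A1 x1) (B (C x2))))
    (B (C x2))); [|module X1].
  apply (f_equal2 plus); [reflexivity|].
  exact (f_equal (fun v => B (C v)) H3).
Qed.

(** * Variation of constants *)

(** With [r = t - s - h], the increment is [T r (z (s + h) - T h (z s))]. Both terms in the bracket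
    are expanded to first order in [h]; the parts [A (z s)] cancel and [h w] survives. *)
Lemma duhamel_rderiv (X : C_NormedSpace) (A : LinOp X) (T : R -> X -> X)
    (K : R) (z : R -> X) (t s : R) (w : X) :
  generates A T -> 0 < K -> bounded_by X T (fun _ => K) -> 0 <= s < t ->
  dom A (z s) -> rderiv X z s (plus (A (z s)) w) ->
  rderiv X (fun s => T (t - s) (z s)) s (T (t - s) w).
Proof.
intros HG HK Hb Hs Hz Hd eps He.
assert (Hl := bounded_by_const_loc X T K HK Hb).
destruct (HG) as [HT _]; destruct (HT) as (Hlin & H0 & Hadd & _).
(* The remainders [p] and [q] each cost [K * e * h], a quarter of [eps * h]; replacing [T r w] by
   [T (t - s) w] takes the other half. *)
set (e := eps / (4 * K)).
assert (HeK : 0 < e) by (apply Rdiv_lt_0_compat; lra).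
assert (Hd' := proj1 (generates_iff X A T HG _ _) (conj Hz eq_refl)).
destruct (Hd e HeK) as [d1 [Hd1 H1]].
destruct (Hd' e HeK) as [d2 [Hd2 H2]].
destruct (orbit_left_cont X T HT Hl w 0 (t - s) (Rle_refl 0) ltac:(lra)
  (eps / 2) ltac:(lra)) as [d3 [Hd3 H3]].
set (d4 := Rmin (t - s) (Rmin d1 (Rmin d2 d3))).
assert (Hm : d4 <= t - s /\ d4 <= d1 /\ d4 <= d2 /\ d4 <= d3).
{ unfold d4; assert (Ha := Rmin_l (t - s) (Rmin d1 (Rmin d2 d3))).
  assert (Hb' := Rmin_r (t - s) (Rmin d1 (Rmin d2 d3))).
  assert (Hc := Rmin_l d1 (Rmin d2 d3)); assert (Hc' := Rmin_r d1 (Rmin d2 d3)).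
  assert (He1 := Rmin_l d2 d3); assert (He2 := Rmin_r d2 d3); lra. }
exists d4; split; [repeat apply Rmin_glb_lt; lra|]; intros h Hh.
specialize (H1 h ltac:(lra)); specialize (H2 h ltac:(lra)).
specialize (H3 (t - (s + h)) ltac:(lra) ltac:(lra)).
rewrite Rplus_0_l, H0 in H2; cbv beta.
set (r := t - (s + h)) in *.
assert (Hr : 0 <= r) by (unfold r; lra).
assert (Hlr := Hlin r Hr).
set (p := minus (minus (z (s + h)) (z s)) (scal (RtoC h) (plus (A (z s)) w))) in *.
set (q := minus (minus (T h (z s)) (z s)) (scal (RtoC h) (A (z s)))) in *.
assert (Hp := Hb r Hr p); assert (Hq := Hb r Hr q).
assert (E : minus (minus (T r (z (s + h))) (T (t - s) (z s)))
    (scal (RtoC h) (T (t - s) w))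
  = plus (T r p) (plus (opp (T r q))
      (scal (RtoC h) (minus (T r w) (T (t - s) w))))).
{ assert (Ep : T r p = minus (minus (T r (z (s + h))) (T r (z s)))
    (scal (RtoC h) (plus (T r (A (z s))) (T r w)))).
  { unfold p; rewrite !(linear_map_minus X X _ Hlr).
    now rewrite (linear_map_scal X X _ Hlr), (linear_plus _ Hlr). }
  assert (Eq : T r q = minus (minus (T (t - s) (z s)) (T r (z s)))
    (scal (RtoC h) (T r (A (z s))))).
  { unfold q; rewrite !(linear_map_minus X X _ Hlr).
    rewrite (linear_map_scal X X _ Hlr), <- Hadd by lra.
    now replace (r + h) with (t - s) by (unfold r; ring). }
  rewrite Ep, Eq; module X. }
refine (Rle_trans _ _ _ (norm_plus3_le X _ _ _ _ E) _).
rewrite norm_opp, norm_scal_eq by lra.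
assert (K * norm p <= K * (e * h)) by (apply Rmult_le_compat_l; lra).
assert (K * norm q <= K * (e * h)) by (apply Rmult_le_compat_l; lra).
assert (h * norm (minus (T r w) (T (t - s) w)) <= h * (eps / 2))
  by (apply Rmult_le_compat_l; lra).
replace (K * (e * h)) with (eps / 4 * h) in * by (unfold e; field; lra).
lra.
Qed.

(** For [r < s] the time [t - r] lies to the right of [t - s], so right continuity of the orbit of
    [z s] and the uniform bound on [T] suffice. *)
Lemma duhamel_left_cont (X : C_NormedSpace) (T : R -> X -> X)
    (K : R) (z : R -> X) (t s : R) :
  C0_semigroup T -> 0 < K -> bounded_by X T (fun _ => K) -> 0 < s <= t ->
  left_cont X z 0 s -> left_cont X (fun s => T (t - s) (z s)) 0 s.
Proof.
intros HT HK Hb Hs Hz eps He; destruct (HT) as (Hlin & _).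
destruct (Hz (eps / (2 * K))) as [d1 [Hd1 H1]];
  [apply Rdiv_lt_0_compat; lra|].
destruct (orbit_right_cont X T HT (z s) (t - s) (eps / 2)) as [d2 [Hd2 H2]];
  [lra|lra|].
exists (Rmin d1 d2); split; [now apply Rmin_glb_lt|]; intros r Hr Hr'.
assert (Hm1 := Rmin_l d1 d2); assert (Hm2 := Rmin_r d1 d2).
specialize (H1 r ltac:(lra) ltac:(lra)); specialize (H2 (s - r) ltac:(lra)).
replace (t - s + (s - r)) with (t - r) in H2 by ring.
assert (H3 := Hb (t - r) ltac:(lra) (minus (z r) (z s))).
rewrite (linear_map_minus X X _ (Hlin (t - r) ltac:(lra))) in H3.
assert (K * norm (minus (z r) (z s)) <= K * (eps / (2 * K)))
  by (apply Rmult_le_compat_l; lra).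
replace (K * (eps / (2 * K))) with (eps / 2) in * by (field; lra).
apply Rle_trans with (1 := norm_dist_le X _ (T (t - r) (z s)) _); lra.
Qed.

(* [z' = A z + w] implies [z t - T t (z 0) = int_0^t T (t - s) (w s) ds]; the
   integral enters only through the bound [G t - G 0]. *)
Lemma duhamel_bound (X : C_NormedSpace) (A : LinOp X) (T : R -> X -> X)
    (K : R) (z w : R -> X) (t : R) (G : R -> R) :
  generates A T -> 0 < K -> bounded_by X T (fun _ => K) -> 0 <= t ->
  (forall s, 0 < s <= t -> left_cont X z 0 s) ->
  (forall s, 0 <= s < t ->
     dom A (z s) /\ rderiv X z s (plus (A (z s)) (w s))) ->
  (forall r s, r <= s -> G r <= G s) ->
  (forall s, 0 <= s < t -> exists g,
     norm (T (t - s) (w s)) <= g /\ is_derive G s g) ->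
  norm (minus (z t) (T t (z 0))) <= G t - G 0.
Proof.
intros HG HK Hb Ht Hc Hd HGm HGd; destruct (HG) as [HT _].
assert (H := mean_value X (fun s => T (t - s) (z s)) G 0 t Ht); cbv beta in H.
rewrite Rminus_diag, Rminus_0_r in H.
replace (T 0 (z t)) with (z t) in H by (symmetry; apply HT).
apply H; [|easy|].
- intros s Hs; apply (duhamel_left_cont X T K); auto.
- intros s Hs; destruct (HGd s Hs) as [g Hg]; exists (T (t - s) (w s)), g.
  split; [|exact Hg]; destruct (Hd s Hs).
  now apply (duhamel_rderiv X A T K).
Qed.

(** Completeness is given for the factors, so the uniform boundedness principle is applied to [T] on
    each coordinate subspace and the two bounds are added. *)
Lemma loc_bounded_prod (X1 X2 : C_NormedSpace)
    (T : R -> prod_NormedModule C_AbsRing X1 X2 ->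
      prod_NormedModule C_AbsRing X1 X2) :
  seq_complete X1 -> seq_complete X2 -> C0_semigroup T ->
  loc_bounded (prod_NormedModule C_AbsRing X1 X2) T.
Proof.
intros H1 H2 HT; set (X := prod_NormedModule C_AbsRing X1 X2).
destruct (HT) as (Hlin & H0 & _).
assert (Hpt : forall x : X, exists K delta, 0 < delta /\
  forall t, 0 <= t <= delta -> norm (T t x) <= K).
{ intros x; destruct (semigroup_near_zero X T HT x 1 Rlt_0_1) as [d [Hd1 Hd2]].
  exists (1 + norm x), (d / 2); split; [lra|]; intros t Ht.
  specialize (Hd2 t ltac:(lra)).
  assert (H := norm_plus_le X (T t x) (minus (T t x) x) x ltac:(module X)).
  refine (Rle_trans _ _ _ H _); apply Rplus_le_compat_r; exact Hd2. }
destruct (uniform_boundedness X1 X (fun t x1 => T t (x1, zero)) H1)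
  as (K1 & d1 & Hd1 & HK1).
{ intros t Ht; specialize (Hlin t Ht); split.
  - intros x y; rewrite <- (linear_plus _ Hlin).
    apply f_equal; refine (f_equal (pair (plus x y)) _); simpl; module X2.
  - intros k x; refine (eq_trans _ (linear_scal _ Hlin k _)).
    apply f_equal; refine (f_equal (pair (scal k x)) _); simpl; module X2.
  - destruct (linear_map_bound X X _ Hlin) as [L [HL1 HL2]].
    exists L; split; [easy|]; intros x; apply Rle_trans with (1 := HL2 _).
    apply Rmult_le_compat_l; [lra|].
    apply Rle_trans with (1 := norm_pair_le X1 X2 _); simpl.
    rewrite norm_zero; lra. }
{ intros x; apply Hpt. }
destruct (uniform_boundedness X2 X (fun t x2 => T t (zero, x2)) H2)
  as (K2 & d2 & Hd2 & HK2).
{ intros t Ht; specialize (Hlin t Ht); split.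
  - intros x y; rewrite <- (linear_plus _ Hlin).
    apply f_equal; refine (f_equal (fun v => (v, plus x y)) _); simpl; module X1.
  - intros k x; refine (eq_trans _ (linear_scal _ Hlin k _)).
    apply f_equal; refine (f_equal (fun v => (v, scal k x)) _); simpl; module X1.
  - destruct (linear_map_bound X X _ Hlin) as [L [HL1 HL2]].
    exists L; split; [easy|]; intros x; apply Rle_trans with (1 := HL2 _).
    apply Rmult_le_compat_l; [lra|].
    apply Rle_trans with (1 := norm_pair_le X1 X2 _); simpl.
    rewrite norm_zero; lra. }
{ intros x; apply Hpt. }
exists (Rabs K1 + Rabs K2 + 1), (Rmin d1 d2).
assert (Ha1 := Rabs_pos K1); assert (Ha2 := Rabs_pos K2).
split; [lra|]; split; [now apply Rmin_glb_lt|]; intros t Ht x.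
assert (Hm1 := Rmin_l d1 d2); assert (Hm2 := Rmin_r d1 d2).
specialize (HK1 t ltac:(lra) (fst x)); specialize (HK2 t ltac:(lra) (snd x)).
assert (E : T t x = plus (T t (fst x, zero)) (T t (zero, snd x))).
{ rewrite <- (linear_plus _ (Hlin t (proj1 Ht))); apply f_equal.
  destruct x as [x1 x2]; apply (f_equal2 pair); simpl;
    [module X1|module X2]. }
refine (Rle_trans _ _ _ (norm_plus_le X _ _ _ E) _).
assert (Hx1 := norm_fst_le X1 X2 x); assert (Hx2 := norm_snd_le X1 X2 x).
assert (Hx := norm_ge_0 (fst x)); assert (Hx' := norm_ge_0 (snd x)).
assert (K1 * norm (fst x) <= Rabs K1 * norm x).
{ apply Rle_trans with (Rabs K1 * norm (fst x)).
  - apply Rmult_le_compat_r; [easy|apply Rle_abs].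
  - now apply Rmult_le_compat_l. }
assert (K2 * norm (snd x) <= Rabs K2 * norm x).
{ apply Rle_trans with (Rabs K2 * norm (snd x)).
  - apply Rmult_le_compat_r; [easy|apply Rle_abs].
  - now apply Rmult_le_compat_l. }
assert (0 <= norm x) by apply norm_ge_0.
lra.
Qed.

Lemma linear_fst (X1 X2 : C_NormedSpace) :
  is_linear (fun x : prod_NormedModule C_AbsRing X1 X2 => fst x).
Proof.
split; [reflexivity|reflexivity|].
exists 1; split; [lra|]; intros x; rewrite Rmult_1_l; apply norm_fst_le.
Qed.

Lemma linear_snd (X1 X2 : C_NormedSpace) :
  is_linear (fun x : prod_NormedModule C_AbsRing X1 X2 => snd x).
Proof.
split; [reflexivity|reflexivity|].
exists 1; split; [lra|]; intros x; rewrite Rmult_1_l; apply norm_snd_le.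
Qed.

(** The second component solves [z' = A2 z]; the bound of [duhamel_bound] with zero input and
    [G = 0] is uniqueness for this equation. *)
Lemma block_orbit_snd (X1 X2 Y : C_NormedSpace) (A1 : LinOp X1) (A2 : LinOp X2)
    (T2 : R -> X2 -> X2) (B : Y -> X1) (C : X2 -> Y)
    (hB : is_linear B) (hC : is_linear C)
    (T : R -> prod_NormedModule C_AbsRing X1 X2 ->
      prod_NormedModule C_AbsRing X1 X2) (K : R) :
  generates A2 T2 -> 0 < K -> bounded_by X2 T2 (fun _ => K) ->
  generates (block_op A1 A2 hB hC) T ->
  loc_bounded (prod_NormedModule C_AbsRing X1 X2) T ->
  forall x t, 0 <= t -> dom (block_op A1 A2 hB hC) x ->
    snd (T t x) = T2 t (snd x).
Proof.
intros HG2 HK Hb HG Hl x t Ht Hx.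
apply minus_zero_eq, norm_eq_zero, Rle_antisym; [|apply norm_ge_0].
destruct (HG) as [HT _]; assert (H0 : T 0 x = x) by apply HT.
assert (H2 : is_linear (T2 t)) by now apply HG2.
assert (H : norm (minus (snd (T t x)) (T2 t (snd (T 0 x)))) <= 0 - 0);
  [|rewrite H0 in H; rewrite Rminus_0_r in H; exact H].
apply (duhamel_bound X2 A2 T2 K (fun s => snd (T s x)) (fun _ => zero) t
  (fun _ => 0) HG2 HK Hb Ht).
- intros s Hs; apply (left_cont_linear _ _ _ _ _ _ (linear_snd X1 X2)).
  apply orbit_left_cont; try easy; lra.
- intros s Hs; split.
  + apply (generator_commute _ _ T HG s x (proj1 Hs) Hx).
  + assert (H := orbit_rderiv _ _ T HG s x (proj1 Hs) Hx).
    apply (rderiv_linear _ _ _ _ _ _ (linear_snd X1 X2)) in H.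
    replace (plus (A2 (snd (T s x))) zero) with (A2 (snd (T s x)))
      by (module X2).
    exact H.
- intros; lra.
- intros s Hs; exists 0; split.
  + rewrite (linear_map_zero X2 X2 (T2 (t - s))), norm_zero; [lra|].
    apply HG2; lra.
  + apply (is_derive_const (V := R_NormedModule)).
Qed.

Lemma block_orbit_fst (X1 X2 Y : C_NormedSpace) (A1 : LinOp X1) (A2 : LinOp X2)
    (T1 : R -> X1 -> X1) (B : Y -> X1) (C : X2 -> Y)
    (hB : is_linear B) (hC : is_linear C)
    (T : R -> prod_NormedModule C_AbsRing X1 X2 ->
      prod_NormedModule C_AbsRing X1 X2) (K : R) (G : R -> R) :
  generates A1 T1 -> 0 < K -> bounded_by X1 T1 (fun _ => K) ->
  generates (block_op A1 A2 hB hC) T ->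
  loc_bounded (prod_NormedModule C_AbsRing X1 X2) T ->
  forall x t, 0 <= t -> dom (block_op A1 A2 hB hC) x ->
  (forall r s, r <= s -> G r <= G s) ->
  (forall s, 0 <= s < t -> exists g,
     norm (T1 (t - s) (B (C (snd (T s x))))) <= g /\ is_derive G s g) ->
  norm (minus (fst (T t x)) (T1 t (fst x))) <= G t - G 0.
Proof.
intros HG1 HK Hb HG Hl x t Ht Hx HGm HGd.
destruct (HG) as [HT _]; assert (H0 : T 0 x = x) by apply HT.
assert (H : norm (minus (fst (T t x)) (T1 t (fst (T 0 x)))) <= G t - G 0);
  [|rewrite H0 in H; exact H].
apply (duhamel_bound X1 A1 T1 K (fun s => fst (T s x))
  (fun s => B (C (snd (T s x)))) t G HG1 HK Hb Ht); [| |easy|easy].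
- intros s Hs; apply (left_cont_linear _ _ _ _ _ _ (linear_fst X1 X2)).
  apply orbit_left_cont; try easy; lra.
- intros s Hs; split.
  + apply (generator_commute _ _ T HG s x (proj1 Hs) Hx).
  + assert (H := orbit_rderiv _ _ T HG s x (proj1 Hs) Hx).
    exact (rderiv_linear _ _ _ _ _ _ (linear_fst X1 X2) H).
Qed.

(** * Bounds on the coupling term *)

Lemma linear_comp_bound (U V W : C_NormedSpace) (f : V -> W) (g : U -> V) :
  is_linear f -> is_linear g ->
  exists c, 0 < c /\ forall x, norm (f (g x)) <= c * norm x.
Proof.
intros Hf Hg; destruct (linear_map_bound _ _ _ Hf) as [L [HL1 HL2]].
destruct (linear_map_bound _ _ _ Hg) as [M [HM1 HM2]].
exists (L * M); split; [now apply Rmult_lt_0_compat|]; intros x.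
apply Rle_trans with (1 := HL2 _); rewrite Rmult_assoc.
apply Rmult_le_compat_l; [lra|easy].
Qed.

(** The sign condition covers both majorants needed below: a multiple of [exp (omega * s)], and a
    negative multiple of [exp (- omega * s)]. *)
Lemma exp_scal_increasing (c k r s : R) :
  0 <= c * k -> r <= s -> c * exp (k * r) <= c * exp (k * s).
Proof.
intros Hck Hrs.
assert (Hmon : forall u v, u <= v -> exp u <= exp v).
{ intros u v [H| ->]; [now apply Rlt_le, exp_increasing|lra]. }
destruct (Rle_lt_dec 0 c) as [Hc|Hc].
- destruct Hc as [Hc|<-]; [|lra].
  assert (Hk : 0 <= k) by (apply Rmult_le_reg_l with c; lra).
  apply Rmult_le_compat_l; [lra|]; apply Hmon.
  now apply Rmult_le_compat_l.
- assert (Hk : k <= 0) by (apply Rmult_le_reg_l with (- c); lra).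
  assert (H : exp (k * s) <= exp (k * r)).
  { apply Hmon; assert (- k * r <= - k * s) by (apply Rmult_le_compat_l; lra).
    lra. }
  assert (- c * exp (k * s) <= - c * exp (k * r))
    by (apply Rmult_le_compat_l; lra).
  lra.
Qed.

(** The constant is the integral of [M * exp (- omega * (t - s)) * c], bounded by that over all
    times. Leaving [phi] free serves twice: a crude [phi] gives boundedness of [T], and a small one,
    valid after a restart at [tau], gives decay. *)
Lemma coupling_bound_exp_fst (X1 X2 Y : C_NormedSpace) (A1 : LinOp X1)
    (A2 : LinOp X2) (T1 : R -> X1 -> X1) (B : Y -> X1) (C : X2 -> Y)
    (hB : is_linear B) (hC : is_linear C)
    (T : R -> prod_NormedModule C_AbsRing X1 X2 ->
      prod_NormedModule C_AbsRing X1 X2) (M omega c : R) :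
  generates A1 T1 -> 0 < M -> 0 < omega ->
  bounded_by X1 T1 (fun t => M * exp (- omega * t)) ->
  generates (block_op A1 A2 hB hC) T ->
  loc_bounded (prod_NormedModule C_AbsRing X1 X2) T ->
  0 < c -> (forall v, norm (B (C v)) <= c * norm v) ->
  forall x t phi, 0 <= t -> dom (block_op A1 A2 hB hC) x -> 0 <= phi ->
  (forall s, 0 <= s < t -> norm (snd (T s x)) <= phi) ->
  norm (minus (fst (T t x)) (T1 t (fst x))) <= M * c / omega * phi.
Proof.
intros HG1 HM Hw Hb HG Hl Hc HBC x t phi Ht Hx Hphi Hsnd.
assert (HK := bounded_by_exp_const X1 T1 M omega HM Hw Hb).
(* Chosen so that [k * exp (omega * s)] has the derivative
   [M * exp (- omega * (t - s)) * (c * phi)]. *)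
set (k := M * c / omega * phi * exp (- omega * t)).
assert (Hk : 0 <= k).
{ unfold k; apply Rmult_le_pos; [apply Rmult_le_pos; [|easy]|
    apply Rlt_le, exp_pos].
  apply Rlt_le, Rdiv_lt_0_compat; [now apply Rmult_lt_0_compat|easy]. }
apply Rle_trans with (k * exp (omega * t) - k * exp (omega * 0)).
- apply (block_orbit_fst X1 X2 Y A1 A2 T1 B C hB hC T M
    (fun s => k * exp (omega * s)) HG1 HM HK HG Hl x t Ht Hx).
  + intros r s Hrs; apply exp_scal_increasing; [apply Rmult_le_pos; lra|easy].
  + intros s Hs; exists (k * omega * exp (omega * s)).
    split; [|apply is_derive_exp_scal].
    apply Rle_trans with (1 := Hb (t - s) ltac:(lra) _).
    replace (k * omega * exp (omega * s))
      with (M * exp (- omega * (t - s)) * (c * phi)).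
    * apply Rmult_le_compat_l; [apply Rmult_le_pos; [lra|apply Rlt_le, exp_pos]|].
      apply Rle_trans with (1 := HBC _).
      apply Rmult_le_compat_l; [lra|now apply Hsnd].
    * unfold k; replace (- omega * (t - s)) with (- omega * t + omega * s) by ring.
      rewrite exp_plus; field; lra.
- assert (E : k * exp (omega * t) = M * c / omega * phi).
  { unfold k; rewrite Rmult_assoc, <- exp_plus.
    replace (- omega * t + omega * t) with 0 by ring; rewrite exp_0; ring. }
  assert (0 <= k * exp (omega * 0))
    by (apply Rmult_le_pos; [easy|apply Rlt_le, exp_pos]).
  lra.
Qed.

(** Now the decay sits in the input, and [1 / omega] is the integral of [exp (- omega * s)]. The
    factor [norm (snd x)] is kept because it is exponentially small once the orbit is restarted at
    [tau]. *)
Lemma coupling_bound_exp_snd (X1 X2 Y : C_NormedSpace) (A1 : LinOp X1)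
    (A2 : LinOp X2) (T1 : R -> X1 -> X1) (B : Y -> X1) (C : X2 -> Y)
    (hB : is_linear B) (hC : is_linear C)
    (T : R -> prod_NormedModule C_AbsRing X1 X2 ->
      prod_NormedModule C_AbsRing X1 X2) (K M omega c : R) :
  generates A1 T1 -> 0 < K -> bounded_by X1 T1 (fun _ => K) ->
  0 < M -> 0 < omega ->
  generates (block_op A1 A2 hB hC) T ->
  loc_bounded (prod_NormedModule C_AbsRing X1 X2) T ->
  0 < c -> (forall v, norm (B (C v)) <= c * norm v) ->
  forall x t, 0 <= t -> dom (block_op A1 A2 hB hC) x ->
  (forall s, 0 <= s < t ->
     norm (snd (T s x)) <= M * exp (- omega * s) * norm (snd x)) ->
  norm (minus (fst (T t x)) (T1 t (fst x)))
  <= K * c * M / omega * norm (snd x).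
Proof.
intros HG1 HK Hb HM Hw HG Hl Hc HBC x t Ht Hx Hsnd.
set (k := K * c * M / omega * norm (snd x)).
assert (Hk : 0 <= k).
{ apply Rmult_le_pos; [|apply norm_ge_0].
  apply Rlt_le, Rdiv_lt_0_compat; [|easy].
  repeat apply Rmult_lt_0_compat; easy. }
apply Rle_trans with (- k * exp (- omega * t) - - k * exp (- omega * 0)).
- apply (block_orbit_fst X1 X2 Y A1 A2 T1 B C hB hC T K
    (fun s => - k * exp (- omega * s)) HG1 HK Hb HG Hl x t Ht Hx).
  + intros r s Hrs; apply exp_scal_increasing; [|easy].
    replace (- k * - omega) with (k * omega) by ring; apply Rmult_le_pos; lra.
  + intros s Hs; exists (- k * - omega * exp (- omega * s)).
    split; [|apply is_derive_exp_scal].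
    apply Rle_trans with (1 := Hb (t - s) ltac:(lra) _).
    replace (- k * - omega * exp (- omega * s))
      with (K * (c * (M * exp (- omega * s) * norm (snd x))))
      by (unfold k; field; lra).
    apply Rmult_le_compat_l; [lra|].
    apply Rle_trans with (1 := HBC _).
    apply Rmult_le_compat_l; [lra|now apply Hsnd].
- rewrite Rmult_0_r, exp_0.
  assert (0 <= k * exp (- omega * t))
    by (apply Rmult_le_pos; [easy|apply Rlt_le, exp_pos]).
  lra.
Qed.

(** * Extension by density and comparison of decay rates *)

Lemma block_dense (X1 X2 Y : C_NormedSpace) (A1 : LinOp X1) (A2 : LinOp X2)
    (B : Y -> X1) (C : X2 -> Y) (hB : is_linear B) (hC : is_linear C) :
  (forall x eps, 0 < eps -> exists x', dom A1 x' /\ norm (minus x' x) <= eps) ->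
  (forall x eps, 0 < eps -> exists x', dom A2 x' /\ norm (minus x' x) <= eps) ->
  forall x eps, 0 < eps -> exists x', dom (block_op A1 A2 hB hC) x' /\
    norm (minus x' x) <= eps.
Proof.
intros H1 H2 x eps He.
destruct (H1 (fst x) (eps / 2)) as [x1 [Hx1 Hx1']]; [lra|].
destruct (H2 (snd x) (eps / 2)) as [x2 [Hx2 Hx2']]; [lra|].
exists (x1, x2); split; [now split|].
apply Rle_trans with (1 := norm_pair_le X1 X2 _).
replace eps with (eps / 2 + eps / 2) by lra.
apply Rplus_le_compat; [exact Hx1'|exact Hx2'].
Qed.

Lemma dense_bound (U V : C_NormedSpace) (D : U -> Prop) (f : U -> V) (K : R) :
  (forall x eps, 0 < eps -> exists x', D x' /\ norm (minus x' x) <= eps) ->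
  is_linear f -> 0 <= K -> (forall x, D x -> norm (f x) <= K * norm x) ->
  forall x, norm (f x) <= K * norm x.
Proof.
intros HD Hf HK H x; apply le_epsilon; intros eps He.
destruct (linear_map_bound _ _ _ Hf) as [L [HL1 HL2]].
destruct (HD x (eps / (L + K))) as [x' [Hx1 Hx2]];
  [apply Rdiv_lt_0_compat; lra|].
assert (H1 := H x' Hx1); assert (H2 := HL2 (minus x' x)).
rewrite (linear_map_minus U V f Hf) in H2.
assert (H3 := norm_minus_le V (f x) (f x') (minus (f x') (f x))
  ltac:(module V)).
assert (H4 := norm_plus_le U x' (minus x' x) x ltac:(module U)).
assert (H5 : K * norm x' <= K * (norm (minus x' x) + norm x))
  by (apply Rmult_le_compat_l; lra).
assert (H6 : (L + K) * norm (minus x' x) <= (L + K) * (eps / (L + K)))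
  by (apply Rmult_le_compat_l; lra).
replace ((L + K) * (eps / (L + K))) with eps in H6 by (field; lra).
lra.
Qed.

(** The form in which the estimates arise: on the domain, where orbits are differentiable, and with
    the power taken at [t / 2]. Density removes the first restriction and homogeneity of the power
    the second. *)
Lemma polynomially_stable_intro (X : C_NormedSpace) (A : LinOp X)
    (T : R -> X -> X) (Ainv : X -> X) (alpha K M : R) :
  generates A T ->
  (forall x eps, 0 < eps -> exists x', dom A x' /\ norm (minus x' x) <= eps) ->
  (forall w, resolvent_set A (0, w)) -> bounded_inverse A Ainv ->
  0 <= K -> (forall t x, 0 <= t -> dom A x -> norm (T t x) <= K * norm x) ->
  0 <= M -> (forall t x, 0 < t -> dom A x ->
    norm (T t (Ainv x)) <= M * Rpower (t / 2) (- 1 / alpha) * norm x) ->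
  polynomially_stable alpha A T.
Proof.
intros HG HD Hres Hinv HK HbT HM Hdec; destruct (HG) as [(Hlin & _) _].
split; [|split; [easy|]].
- exists K; intros t Ht; apply op_norm_le_intro; [easy|].
  apply (dense_bound X X (dom A) (T t)); auto.
- exists Ainv; split; [easy|].
  set (q := Rpower (/ 2) (- 1 / alpha)).
  assert (Hq : 0 < q) by apply exp_pos.
  (* [q] is [2^(1/alpha)], the price of halving the time; the 1 secures the lower bound that the
     definition asks of the constant. *)
  exists (1 + M * q).
  assert (HMq : 0 <= M * q) by (apply Rmult_le_pos; lra).
  split; [lra|]; intros t Ht.
  assert (Hp : 0 < Rpower t (- 1 / alpha)) by apply exp_pos.
  assert (Hle : forall x : X, norm (T t (Ainv x))
    <= M * Rpower (t / 2) (- 1 / alpha) * norm x).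
  { assert (Hlt := Hlin t ltac:(lra)); destruct Hinv as [Hinv _].
    apply (dense_bound X X (dom A) (fun x => T t (Ainv x)));
      [easy| |apply Rmult_le_pos; [easy|apply Rlt_le, exp_pos]|now auto].
    split.
    - intros x y; now rewrite (linear_plus _ Hinv), (linear_plus _ Hlt).
    - intros k x; refine (eq_trans (f_equal (T t) (linear_scal _ Hinv k x)) _).
      exact (linear_scal _ Hlt k _).
    - exact (linear_comp_bound X X X (T t) Ainv Hlt Hinv). }
  apply op_norm_le_intro; [apply Rmult_le_pos; lra|]; intros x.
  apply Rle_trans with (1 := Hle x).
  apply Rmult_le_compat_r; [apply norm_ge_0|].
  replace (t / 2) with (/ 2 * t) by field.
  rewrite <- Rpower_mult_distr by lra; fold q.
  rewrite <- Rmult_assoc; apply Rmult_le_compat_r; lra.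
Qed.

Lemma exp_le_Rpower (alpha omega : R) : 0 < alpha -> 0 < omega ->
  exists k, 0 < k /\ forall t, 0 < t ->
    exp (- omega * t) <= k * Rpower t (- 1 / alpha).
Proof.
(* After taking logarithms and multiplying by [alpha], the claim with this constant is
   [1 + ln u <= u] at [u = omega * alpha * t]. *)
intros Ha Hw; exists (exp (- (1 + ln (omega * alpha)) / alpha)).
split; [apply exp_pos|]; intros t Ht; unfold Rpower; rewrite <- exp_plus.
assert (Hwa : 0 < omega * alpha) by now apply Rmult_lt_0_compat.
assert (Hu : 0 < omega * alpha * t) by now apply Rmult_lt_0_compat.
assert (Hln : 1 + ln (omega * alpha) + ln t <= omega * alpha * t).
{ rewrite Rplus_assoc, <- ln_mult by easy.
  assert (H := exp_ineq1_le (ln (omega * alpha * t))).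
  rewrite exp_ln in H by easy; lra. }
assert (H : - omega * t <= - (1 + ln (omega * alpha)) / alpha + - 1 / alpha * ln t).
{ apply Rmult_le_reg_r with alpha; [easy|].
  replace ((- (1 + ln (omega * alpha)) / alpha + - 1 / alpha * ln t) * alpha)
    with (- (1 + ln (omega * alpha) + ln t)) by (field; lra).
  lra. }
destruct H as [H| ->]; [now apply Rlt_le, exp_increasing|lra].
Qed.

Lemma Rpower_neg_decreasing (alpha r s : R) : 0 < alpha -> 0 < r <= s ->
  Rpower s (- 1 / alpha) <= Rpower r (- 1 / alpha).
Proof.
intros Ha Hrs; assert (Hln : ln r <= ln s).
{ destruct (proj2 Hrs) as [H| ->]; [apply Rlt_le, ln_increasing; lra|lra]. }
assert (Hi : 0 < / alpha) by now apply Rinv_0_lt_compat.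
assert (H : - 1 / alpha * ln s <= - 1 / alpha * ln r).
{ assert (/ alpha * ln r <= / alpha * ln s) by (apply Rmult_le_compat_l; lra).
  unfold Rdiv; lra. }
unfold Rpower; destruct H as [H| ->]; [now apply Rlt_le, exp_increasing|lra].
Qed.

Lemma exponentially_stable_bound (X : C_NormedSpace) (T : R -> X -> X) :
  C0_semigroup T -> exponentially_stable T ->
  exists M omega, 0 < M /\ 0 < omega /\
    bounded_by X T (fun t => M * exp (- omega * t)).
Proof.
intros (Hlin & _) (M & omega & HM & Hw & Hb).
exists M, omega; split; [lra|split; [easy|]]; intros t Ht.
exact (op_norm_le_bound X X (T t) _ (Hlin t Ht) (Hb t Ht)).
Qed.

Lemma polynomially_stable_bound (X : C_NormedSpace) (alpha : R) (A : LinOp X)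
    (T : R -> X -> X) :
  C0_semigroup T -> polynomially_stable alpha A T ->
  (forall w, resolvent_set A (0, w)) /\
  (exists K, 0 < K /\ bounded_by X T (fun _ => K)) /\
  exists Ainv M, bounded_inverse A Ainv /\ 0 < M /\
    forall t, 0 < t -> forall x,
      norm (T t (Ainv x)) <= M * Rpower t (- 1 / alpha) * norm x.
Proof.
intros (Hlin & _) ((K & HK) & Hres & Ainv & Hinv & M & HM & Hdec).
split; [easy|split].
- exists (Rabs K + 1); assert (H := Rabs_pos K); split; [lra|]; intros t Ht x.
  apply Rle_trans with
    (1 := op_norm_le_bound X X (T t) _ (Hlin t Ht) (HK t Ht) x).
  apply Rmult_le_compat_r; [apply norm_ge_0|].
  assert (H' := Rle_abs K); lra.
- exists Ainv, M; split; [easy|split; [lra|]]; intros t Ht.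
  assert (Hlt := Hlin t ltac:(lra)); destruct Hinv as [HL _].
  apply (op_norm_le_bound X X (fun x => T t (Ainv x))); [|now apply Hdec].
  split.
  + intros x y; now rewrite (linear_plus _ HL), (linear_plus _ Hlt).
  + intros k x; refine (eq_trans (f_equal (T t) (linear_scal _ HL k x)) _).
    exact (linear_scal _ Hlt k _).
  + exact (linear_comp_bound X X X (T t) Ainv Hlt HL).
Qed.

(** * Stability of the coupled semigroup *)

Lemma block_orbit_bounded (X1 X2 Y : C_NormedSpace) (A1 : LinOp X1)
    (A2 : LinOp X2) (T1 : R -> X1 -> X1) (T2 : R -> X2 -> X2)
    (B : Y -> X1) (C : X2 -> Y) (hB : is_linear B) (hC : is_linear C)
    (T : R -> prod_NormedModule C_AbsRing X1 X2 ->
      prod_NormedModule C_AbsRing X1 X2) (K1 K2 L : R) :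
  0 < K1 -> bounded_by X1 T1 (fun _ => K1) ->
  0 < K2 -> bounded_by X2 T2 (fun _ => K2) -> 0 <= L ->
  (forall x t, 0 <= t -> dom (block_op A1 A2 hB hC) x ->
     snd (T t x) = T2 t (snd x)) ->
  (forall x t, 0 <= t -> dom (block_op A1 A2 hB hC) x ->
     norm (minus (fst (T t x)) (T1 t (fst x))) <= L * norm (snd x)) ->
  forall t x, 0 <= t -> dom (block_op A1 A2 hB hC) x ->
    norm (T t x) <= (L + K1 + K2) * norm x.
Proof.
intros HK1 Hb1 HK2 Hb2 HL Hs Hf t x Ht Hx.
apply Rle_trans with (1 := norm_pair_le X1 X2 _).
specialize (Hs x t Ht Hx); specialize (Hf x t Ht Hx); rewrite Hs.
assert (H1 := Hb1 t Ht (fst x)); assert (H2 := Hb2 t Ht (snd x)).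
assert (H3 := norm_plus_le X1 (fst (T t x))
  (minus (fst (T t x)) (T1 t (fst x))) (T1 t (fst x)) ltac:(module X1)).
assert (H4 := norm_fst_le X1 X2 x); assert (H5 := norm_snd_le X1 X2 x).
assert (K1 * norm (fst x) <= K1 * norm x) by (apply Rmult_le_compat_l; lra).
assert (K2 * norm (snd x) <= K2 * norm x) by (apply Rmult_le_compat_l; lra).
assert (L * norm (snd x) <= L * norm x) by (apply Rmult_le_compat_l; lra).
rewrite !Rmult_plus_distr_r.
refine (Rle_trans _ _ _ (Rplus_le_compat_r _ _ _ H3) _); lra.
Qed.

Lemma block_polynomially_stable_snd (X1 X2 Y : C_NormedSpace) (A1 : LinOp X1)
    (A2 : LinOp X2) (T1 : R -> X1 -> X1) (T2 : R -> X2 -> X2)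
    (B : Y -> X1) (C : X2 -> Y) (hB : is_linear B) (hC : is_linear C)
    (T : R -> prod_NormedModule C_AbsRing X1 X2 ->
      prod_NormedModule C_AbsRing X1 X2) (alpha : R) :
  seq_complete X1 -> has_primitives X1 -> seq_complete X2 -> has_primitives X2 ->
  generates A1 T1 -> generates A2 T2 -> generates (block_op A1 A2 hB hC) T ->
  0 < alpha -> exponentially_stable T1 -> polynomially_stable alpha A2 T2 ->
  polynomially_stable alpha (block_op A1 A2 hB hC) T.
Proof.
intros Hc1 Hp1 Hc2 Hp2 HG1 HG2 HG Ha HE HP.
destruct (exponentially_stable_bound X1 T1 (proj1 HG1) HE)
  as (M1 & omega & HM1 & Hw & Hb1).
destruct (polynomially_stable_bound X2 alpha A2 T2 (proj1 HG2) HP)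
  as (Hr2 & (K2 & HK2 & Hb2) & A2inv & M & HA2 & HM & Hdec).
assert (Hr : forall w, resolvent_set (block_op A1 A2 hB hC) (0, w)).
{ intros w; apply resolvent_block; [|apply Hr2].
  exact (exp_stable_resolvent X1 A1 T1 M1 omega Hc1 Hp1 HG1 HM1 Hw Hb1 w). }
destruct (resolvent_zero_inverse _ _ (Hr 0)) as [Ainv HA].
assert (Hl := loc_bounded_prod X1 X2 T Hc1 Hc2 (proj1 HG)).
assert (Hb1' := bounded_by_exp_const X1 T1 M1 omega HM1 Hw Hb1).
destruct (linear_comp_bound _ _ _ B C hB hC) as [c [Hc Hc']].
assert (Hsnd := block_orbit_snd X1 X2 Y A1 A2 T2 B C hB hC T K2 HG2 HK2 Hb2 HG Hl).
assert (Hfst := coupling_bound_exp_fst X1 X2 Y A1 A2 T1 B C hB hC T M1 omega c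
  HG1 HM1 Hw Hb1 HG Hl Hc Hc').
set (L := M1 * c / omega) in *.
assert (HL : 0 < L)
  by (apply Rdiv_lt_0_compat; [now apply Rmult_lt_0_compat|easy]).
assert (HLK : 0 < L * K2) by now apply Rmult_lt_0_compat.
assert (Hbd : forall t x, 0 <= t -> dom (block_op A1 A2 hB hC) x ->
  norm (T t x) <= (L * K2 + M1 + K2) * norm x).
{ apply (block_orbit_bounded X1 X2 Y A1 A2 T1 T2 B C hB hC T M1 K2 (L * K2));
    try easy; [lra|].
  intros x t Ht Hx; rewrite Rmult_assoc; apply (Hfst x t _ Ht Hx).
  - apply Rmult_le_pos; [lra|apply norm_ge_0].
  - intros s Hs; rewrite Hsnd by (easy || lra); apply Hb2; lra. }
set (K := L * K2 + M1 + K2) in *.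
assert (HK : 0 < K) by (unfold K; lra).
destruct (exp_le_Rpower alpha omega Ha Hw) as [ke [Hke Hke']].
destruct HA as (HAlin & HAr & HAl).
destruct (linear_map_bound _ _ _ HAlin) as [ka [Hka Hka']].
(* In order: the first component at [tau] damped by [T1 tau], the coupling over [[tau, t]], and the
   second component at [t]. *)
set (Q := M1 * ke * (K * ka) + L * M + M).
assert (HQ : 0 <= Q).
{ assert (0 < M1 * ke * (K * ka)) by (repeat apply Rmult_lt_0_compat; easy).
  assert (0 < L * M) by now apply Rmult_lt_0_compat.
  unfold Q; lra. }
apply (polynomially_stable_intro _ _ T Ainv alpha K Q); try easy; [|lra|].
- apply block_dense.
  + apply (generator_dense X1 A1 T1 Hp1 HG1).
    exact (bounded_by_const_loc X1 T1 M1 HM1 Hb1').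
  + apply (generator_dense X2 A2 T2 Hp2 HG2).
    exact (bounded_by_const_loc X2 T2 K2 HK2 Hb2).
- intros t x Ht _.
  set (tau := t / 2); assert (Htau : 0 < tau) by (unfold tau; lra).
  set (p := Rpower tau (- 1 / alpha)).
  assert (Hp : 0 < p) by apply exp_pos.
  destruct (HAr x) as [Hy HAy]; set (y := Ainv x) in *.
  assert (Hy2 : snd y = A2inv (snd x)).
  { rewrite <- HAy; symmetry; apply HA2, Hy. }
  destruct (HG) as [(_ & _ & Hadd & _) _].
  assert (Hz : dom (block_op A1 A2 hB hC) (T tau y))
    by (apply (generator_commute _ _ T HG); [lra|exact Hy]).
  assert (Hx1 := norm_fst_le X1 X2 x); assert (Hx2 := norm_snd_le X1 X2 x).
  assert (HMp : 0 <= M * p) by (apply Rmult_le_pos; lra).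
  assert (Htail : forall s, tau <= s -> norm (snd (T s y)) <= M * p * norm x).
  { intros s Hs; rewrite Hsnd, Hy2 by (easy || lra).
    apply Rle_trans with (1 := Hdec s ltac:(lra) (snd x)).
    apply Rmult_le_compat; [|apply norm_ge_0| |exact Hx2].
    - apply Rmult_le_pos; [lra|apply Rlt_le, exp_pos].
    - apply Rmult_le_compat_l; [lra|]; apply Rpower_neg_decreasing; lra. }
  assert (Hf := Hfst (T tau y) tau (M * p * norm x) ltac:(lra) Hz
    ltac:(apply Rmult_le_pos; [easy|apply norm_ge_0])).
  rewrite <- Hadd in Hf by lra.
  replace (tau + tau) with t in Hf by (unfold tau; field).
  specialize (Hf ltac:(intros s Hs; rewrite <- Hadd by lra; apply Htail; lra)).
  assert (Ht2 := Htail t ltac:(unfold tau; lra)).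
  assert (H1 := Hb1 tau ltac:(lra) (fst (T tau y))).
  assert (H2 : norm (fst (T tau y)) <= K * ka * norm x).
  { apply Rle_trans with (1 := norm_fst_le X1 X2 _).
    apply Rle_trans with (1 := Hbd tau y ltac:(lra) Hy).
    rewrite Rmult_assoc; apply Rmult_le_compat_l; [lra|apply Hka']. }
  assert (H3 : M1 * exp (- omega * tau) * norm (fst (T tau y))
    <= M1 * (ke * p) * (K * ka * norm x)).
  { apply Rmult_le_compat; [|apply norm_ge_0| |exact H2].
    - apply Rmult_le_pos; [lra|apply Rlt_le, exp_pos].
    - apply Rmult_le_compat_l; [lra|now apply Hke']. }
  apply Rle_trans with (1 := norm_pair_le X1 X2 _).
  assert (H4 := norm_plus_le X1 (fst (T t y))
    (minus (fst (T t y)) (T1 tau (fst (T tau y)))) (T1 tau (fst (T tau y)))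
    ltac:(module X1)).
  refine (Rle_trans _ _ _ (Rplus_le_compat_r _ _ _ H4) _).
  apply Rle_trans with (L * (M * p * norm x)
    + M1 * (ke * p) * (K * ka * norm x) + M * p * norm x);
    [|right; unfold Q; ring].
  apply Rplus_le_compat; [apply Rplus_le_compat; [exact Hf|]|exact Ht2].
  exact (Rle_trans _ _ _ H1 H3).
Qed.

Lemma block_polynomially_stable_fst (X1 X2 Y : C_NormedSpace) (A1 : LinOp X1)
    (A2 : LinOp X2) (T1 : R -> X1 -> X1) (T2 : R -> X2 -> X2)
    (B : Y -> X1) (C : X2 -> Y) (hB : is_linear B) (hC : is_linear C)
    (T : R -> prod_NormedModule C_AbsRing X1 X2 ->
      prod_NormedModule C_AbsRing X1 X2) (alpha : R) :
  seq_complete X1 -> has_primitives X1 -> seq_complete X2 -> has_primitives X2 ->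
  generates A1 T1 -> generates A2 T2 -> generates (block_op A1 A2 hB hC) T ->
  0 < alpha -> exponentially_stable T2 -> polynomially_stable alpha A1 T1 ->
  polynomially_stable alpha (block_op A1 A2 hB hC) T.
Proof.
intros Hc1 Hp1 Hc2 Hp2 HG1 HG2 HG Ha HE HP.
destruct (exponentially_stable_bound X2 T2 (proj1 HG2) HE)
  as (M2 & omega & HM2 & Hw & Hb2).
destruct (polynomially_stable_bound X1 alpha A1 T1 (proj1 HG1) HP)
  as (Hr1 & (K1 & HK1 & Hb1) & A1inv & M & HA1 & HM & Hdec).
assert (Hr : forall w, resolvent_set (block_op A1 A2 hB hC) (0, w)).
{ intros w; apply resolvent_block; [apply Hr1|].
  exact (exp_stable_resolvent X2 A2 T2 M2 omega Hc2 Hp2 HG2 HM2 Hw Hb2 w). }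
destruct (resolvent_zero_inverse _ _ (Hr 0)) as [Ainv HA].
assert (Hl := loc_bounded_prod X1 X2 T Hc1 Hc2 (proj1 HG)).
assert (Hb2' := bounded_by_exp_const X2 T2 M2 omega HM2 Hw Hb2).
destruct (linear_comp_bound _ _ _ B C hB hC) as [c [Hc Hc']].
assert (Hsnd := block_orbit_snd X1 X2 Y A1 A2 T2 B C hB hC T M2 HG2 HM2 Hb2' HG Hl).
assert (Hfst : forall x t, 0 <= t -> dom (block_op A1 A2 hB hC) x ->
  norm (minus (fst (T t x)) (T1 t (fst x)))
  <= K1 * c * M2 / omega * norm (snd x)).
{ intros x t Ht Hx.
  apply (coupling_bound_exp_snd X1 X2 Y A1 A2 T1 B C hB hC T K1 M2 omega c); try easy.
  intros s Hs; rewrite Hsnd by (easy || lra); apply Hb2; lra. }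
set (L := K1 * c * M2 / omega) in *.
assert (HL : 0 < L).
{ apply Rdiv_lt_0_compat; [repeat apply Rmult_lt_0_compat|]; easy. }
clearbody L.
assert (Hbd := block_orbit_bounded X1 X2 Y A1 A2 T1 T2 B C hB hC T K1 M2 L
  HK1 Hb1 HM2 Hb2' ltac:(lra) Hsnd Hfst).
set (K := L + K1 + M2) in *.
assert (HK : 0 < K) by (unfold K; lra).
destruct (exp_le_Rpower alpha omega Ha Hw) as [ke [Hke Hke']].
destruct HA as (HAlin & HAr & HAl).
destruct (linear_map_bound _ _ _ HAlin) as [ka [Hka Hka']].
destruct HA1 as (HA1lin & HA1r & HA1l).
destruct (linear_map_bound _ _ _ HA1lin) as [k1 [Hk1 Hk1']].
(* In order: [T1 tau A1inv] on the state at [tau], [A1inv] on the coupling over [[tau, t]], [A1inv]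
   on the input [B C] at time [t], and the second component. *)
set (Q := M * K + k1 * (L * (M2 * ke)) + k1 * (c * (M2 * ke * ka))
  + M2 * ke * ka).
assert (HQ : 0 <= Q).
{ assert (0 < M * K) by now apply Rmult_lt_0_compat.
  assert (0 < k1 * (L * (M2 * ke))) by (repeat apply Rmult_lt_0_compat; easy).
  assert (0 < k1 * (c * (M2 * ke * ka)))
    by (repeat apply Rmult_lt_0_compat; easy).
  assert (0 < M2 * ke * ka) by (repeat apply Rmult_lt_0_compat; easy).
  unfold Q; lra. }
apply (polynomially_stable_intro _ _ T Ainv alpha K Q); try easy; [|lra|].
- apply block_dense.
  + apply (generator_dense X1 A1 T1 Hp1 HG1).
    exact (bounded_by_const_loc X1 T1 K1 HK1 Hb1).
  + apply (generator_dense X2 A2 T2 Hp2 HG2).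
    exact (bounded_by_const_loc X2 T2 M2 HM2 Hb2').
(* Here the orbit of [x] itself is estimated, besides that of [y], so [x] is taken in the domain. *)
- intros t x Ht Hx.
  set (tau := t / 2); assert (Htau : 0 < tau) by (unfold tau; lra).
  set (p := Rpower tau (- 1 / alpha)).
  assert (Hp : 0 < p) by apply exp_pos.
  destruct (HAr x) as [Hy HAy]; set (y := Ainv x) in *.
  destruct (HG) as [(_ & _ & Hadd & _) _].
  assert (Hz : dom (block_op A1 A2 hB hC) (T tau x))
    by (apply (generator_commute _ _ T HG); [lra|exact Hx]).
  destruct (generator_commute _ _ T HG t y ltac:(lra) Hy) as [Hu HAu].
  rewrite HAy in HAu.
  assert (Hx0 := norm_ge_0 x).
  assert (Hexp : forall v s, tau <= s -> dom (block_op A1 A2 hB hC) v ->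
    norm (snd (T s v)) <= M2 * ke * p * norm v).
  { intros v s Hs Hv; rewrite Hsnd by (easy || lra).
    apply Rle_trans with (1 := Hb2 s ltac:(lra) _).
    apply Rmult_le_compat; [|apply norm_ge_0| |apply norm_snd_le].
    - apply Rmult_le_pos; [lra|apply Rlt_le, exp_pos].
    - rewrite Rmult_assoc; apply Rmult_le_compat_l; [lra|].
      apply Rle_trans with (exp (- omega * tau)); [|now apply Hke'].
      now apply exp_decreasing. }
  assert (Hu2 : norm (snd (T t y)) <= M2 * ke * ka * p * norm x).
  { apply Rle_trans with (1 := Hexp y t ltac:(unfold tau; lra) Hy).
    replace (M2 * ke * ka * p * norm x) with (M2 * ke * p * (ka * norm x)) by ring.
    apply Rmult_le_compat_l; [|apply Hka'].
    repeat apply Rmult_le_pos; lra. }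
  set (v1 := fst (T t x)); set (z1 := fst (T tau x)).
  assert (Hv1 : norm (minus v1 (T1 tau z1)) <= L * (M2 * ke * p * norm x)).
  { apply Rle_trans with (L * norm (snd (T tau x))).
    - assert (H := Hfst (T tau x) tau ltac:(lra) Hz).
      rewrite <- Hadd in H by lra.
      replace (tau + tau) with t in H by (unfold tau; field); exact H.
    - apply Rmult_le_compat_l; [lra|apply Hexp; [lra|easy]]. }
  assert (Hcom : A1inv (T1 tau z1) = T1 tau (A1inv z1)).
  { destruct (HA1r z1) as [H1 H2].
    destruct (generator_commute X1 A1 T1 HG1 tau (A1inv z1) ltac:(lra) H1)
      as [H3 H4].
    rewrite H2 in H4; rewrite <- H4; now apply HA1l. }
  assert (Hz1 : norm (T1 tau (A1inv z1)) <= M * p * (K * norm x)).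
  { apply Rle_trans with (1 := Hdec tau Htau z1).
    apply Rmult_le_compat_l; [apply Rmult_le_pos; lra|].
    apply Rle_trans with (1 := norm_fst_le X1 X2 _); apply Hbd; [lra|easy]. }
  set (b := B (C (snd (T t y)))).
  (* The first row of [A (T t y) = T t x] gives [fst (T t y) = A1inv (v1 - b)]. Then [v1] is split
     into [T1 tau z1], through which [A1inv] passes, and a coupling term that is already small. *)
  assert (Eu1 : fst (T t y) = plus (T1 tau (A1inv z1))
    (plus (A1inv (minus v1 (T1 tau z1))) (opp (A1inv b)))).
  { assert (Hv : plus (A1 (fst (T t y))) b = v1) by exact (f_equal fst HAu).
    assert (Hu1 := HA1l (fst (T t y)) (proj1 Hu)).
    rewrite <- Hu1 at 1.
    replace (A1 (fst (T t y))) with (minus v1 b) by (rewrite <- Hv; module X1).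
    rewrite <- Hcom, !(linear_map_minus X1 X1 A1inv HA1lin); module X1. }
  assert (H1 := norm_plus3_le X1 _ _ _ _ Eu1); rewrite norm_opp in H1.
  assert (H2 : norm (A1inv (minus v1 (T1 tau z1)))
    <= k1 * (L * (M2 * ke * p * norm x))).
  { apply Rle_trans with (1 := Hk1' _); apply Rmult_le_compat_l; [lra|exact Hv1]. }
  assert (H3 : norm (A1inv b) <= k1 * (c * (M2 * ke * ka * p * norm x))).
  { apply Rle_trans with (1 := Hk1' _); apply Rmult_le_compat_l; [lra|].
    apply Rle_trans with (1 := Hc' _); apply Rmult_le_compat_l; [lra|exact Hu2]. }
  apply Rle_trans with (1 := norm_pair_le X1 X2 _).
  apply Rle_trans with (M * p * (K * norm x) + k1 * (L * (M2 * ke * p * norm x))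
    + k1 * (c * (M2 * ke * ka * p * norm x)) + M2 * ke * ka * p * norm x);
    [|right; unfold Q; ring].
  apply Rplus_le_compat; [|exact Hu2].
  refine (Rle_trans _ _ _ H1 _).
  apply Rplus_le_compat; [apply Rplus_le_compat; [exact Hz1|exact H2]|exact H3].
Qed.

Theorem theorem9 :
  forall (X1 X2 : HilbertSpace) (Y : C_BanachSpace)
    (A1 : LinOp X1) (A2 : LinOp X2)
    (T1 : R -> X1 -> X1) (T2 : R -> X2 -> X2)
    (B : Y -> X1) (C : X2 -> Y)
    (hB : is_linear B) (hC : is_linear C),
  generates A1 T1 -> generates A2 T2 ->
  forall T : R -> X1 * X2 -> X1 * X2,
  let A := block_op A1 A2 hB hC in
  generates A T ->
  (forall alpha2 : R, 0 < alpha2 ->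
     exponentially_stable T1 -> polynomially_stable alpha2 A2 T2 ->
     polynomially_stable alpha2 A T) /\
  (forall alpha1 : R, 0 < alpha1 ->
     exponentially_stable T2 -> polynomially_stable alpha1 A1 T1 ->
     polynomially_stable alpha1 A T).
Proof.
intros X1 X2 Y A1 A2 T1 T2 B C hB hC HG1 HG2 T A HG.
assert (Hc1 := seq_complete_banach X1); assert (Hp1 := has_primitives_banach X1).
assert (Hc2 := seq_complete_banach X2); assert (Hp2 := has_primitives_banach X2).
split; intros alpha Ha HE HP.
- exact (block_polynomially_stable_snd X1 X2 Y A1 A2 T1 T2 B C hB hC T alpha
    Hc1 Hp1 Hc2 Hp2 HG1 HG2 HG Ha HE HP).
- exact (block_polynomially_stable_fst X1 X2 Y A1 A2 T1 T2 B C hB hC T alpha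
    Hc1 Hp1 Hc2 Hp2 HG1 HG2 HG Ha HE HP).
Qed.
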